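(* Let $\tau>0$, let $\Theta=(\alpha,\beta)\subset(0,\tau)$ be a bounded interval and let $\vartheta_0\in\Theta$. Let $g_1,g_2$ be known positive bounded functions on $[0,\tau]$ with $g_1(t)<g_2(t)$ for all $t$, and let $h_1,h_2$ be (unknown) functions on $[0,\tau]$. Suppose that one observes $n$ independent Poisson processes $X^n=(X_1,\ldots,X_n)$, $X_j=\{X_j(t),0\le t\le\tau\}$, each with the bounded positive intensity function $$\lambda_*(t)=[g_1(t)+h_1(t)]\,1_{\{t<\vartheta_0\}}+[g_2(t)+h_2(t)]\,1_{\{t\ge\vartheta_0\}},\qquad 0\le t\le\tau,$$ while the statistician uses the (in general wrong) parametric model $$\lambda(\vartheta,t)=g_1(t)\,1_{\{t<\vartheta\}}+g_2(t)\,1_{\{t\ge\vartheta\}},\qquad 0\le t\le\tau,\ \vartheta\in\Theta .$$ Suppose that for all $t$ $$0<g_1(t)+h_1(t)<\frac{g_2(t)-g_1(t)}{\ln\frac{g_2(t)}{g_1(t)}}<g_2(t)+h_2(t).$$ Then the minimum over $\vartheta\in\Theta$ of the Kullback-Leibler distance $$J_{KL}(\vartheta)=\int_0^\tau\left[\frac{\lambda(\vartheta,t)}{\lambda_*(t)}-1-\ln\frac{\lambda(\vartheta,t)}{\lambda_*(t)}\right]\lambda_*(t)\,dt$$ is attained at $\vartheta_*=\vartheta_0$, and the (pseudo-)maximum likelihood estimator $\hat\vartheta_n$ and the (pseudo-)Bayesian estimator $\tilde\vartheta_n$ constructed from the model $\{\lambda(\vartheta,\cdot),\vartheta\in\Theta\}$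 are consistent for $\vartheta_0$, i.e. $\hat\vartheta_n\to\vartheta_0$ and $\tilde\vartheta_n\to\vartheta_0$ in probability as $n\to\infty$ (under the law of the observations with intensity $\lambda_*$).
   Context: A Poisson process with intensity function $\lambda_*$ on $[0,\tau]$ is a c\`adl\`ag counting process $X$ with $X(0)=0$, independent increments on disjoint intervals, and $X(t)-X(s)$ Poisson distributed with mean $\int_s^t\lambda_*(r)\,dr$ for $s<t$. The (pseudo-)likelihood ratio function is $$L(\vartheta,X^n)=\exp\left\{\sum_{j=1}^n\int_0^\tau\ln\lambda(\vartheta,t)\,dX_j(t)-n\int_0^\tau[\lambda(\vartheta,t)-1]\,dt\right\},$$ calculated with the model $\lambda(\vartheta,t)$ but with the observations $X^n$ of intensity $\lambda_*$. Since $L(\cdot,X^n)$ has jumps in $\vartheta$, the maximum likelihood estimator $\hat\vartheta_n$ is defined by $$\max\left[L(\hat\vartheta_n+,X^n),L(\hat\vartheta_n-,X^n)\right]=\sup_{\vartheta\in\Theta}L(\vartheta,X^n).$$ The Bayesian estimator, for quadratic loss and a continuous positive prior density $p$ on $\Theta$, is $$\tilde\vartheta_n=\frac{\int_\alpha^\beta\theta\,p(\theta)L(\theta,X^n)\,d\theta}{\int_\alpha^\beta p(\theta)L(\theta,X^n)\,d\theta}.$$ *)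

(* Defs.v *)
From HB Require Import structures.
From mathcomp Require Import all_boot all_order all_algebra finmap.
From mathcomp Require Import all_classical all_reals all_analysis.

Set Implicit Arguments.
Unset Strict Implicit.
Unset Printing Implicit Defensive.
Import Order.TTheory GRing.Theory Num.Theory.
Import numFieldNormedType.Exports.

Local Open Scope classical_set_scope.
Local Open Scope ring_scope.

Section independence.
Context d (T : measurableType d) (R : realType).

Definition mutual_indep (P : probability T R) (I : choiceType)
    (G : I -> set (set T)) : Prop :=
  forall (J : {fset I}) (A : I -> set T),
    (forall i, i \in J -> G i (A i)) ->
    P (\bigcap_(i in [set` J]) A i) = (\prod_(i <- J) P (A i))%E.

(* sigma-algebra generated by the variables Y t, t in D *)
Definition sigma_process (D : set R) (Y : R -> T -> R) : set (set T) :=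
  <<s \bigcup_(t in D) g_sigma_algebra_preimage (Y t) >>.

End independence.

(* A path on [0, tau] is represented by a nondecreasing right-continuous
   function on the whole line, so that it has a Lebesgue-Stieltjes measure; only
   its restriction to [0, tau] is constrained and used.  Left limits exist by
   monotonicity.  Unit jumps are not required: the Poisson increments force them
   almost surely. *)
Record poisson_process d (T : measurableType d) (R : realType)
    (P : probability T R) (tau : R) (lam : R -> R) (X : T -> cumulative R R)
    : Prop := {
  pp_measurable : forall t, t \in `[0, tau] ->
    measurable_fun [set: T] (fun w => X w t : R) ;
  pp_counting : forall w t, t \in `[0, tau] -> X w t \is a Num.nat ;
  pp_start : forall w, X w 0 = 0 ;
  pp_indep_increments : forall t : nat -> R,
    {homo t : i j / (i <= j)%N >-> i <= j} ->
    (forall i, t i \in `[0, tau]) ->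
    mutual_indep P (fun i =>
      g_sigma_algebra_preimage (fun w => X w (t i.+1) - X w (t i) : R)) ;
  pp_poisson_increments : forall s t, 0 <= s -> s < t -> t <= tau ->
    forall k : nat, P [set w | X w t - X w s = k%:R] =
      (poisson_pmf (\int[lebesgue_measure]_(r in `[s, t]) lam r) k)%:E }.

Definition independent_processes d (T : measurableType d) (R : realType)
    (P : probability T R) (tau : R) (X : nat -> T -> cumulative R R) : Prop :=
  mutual_indep P (fun j => sigma_process `[0, tau] (fun t w => X j w t)).

Section model.
Context {R : realType}.

Definition switch_intensity (a b : R -> R) (theta t : R) : R :=
  a t * (t < theta)%R%:R + b t * (theta <= t)%R%:R.

(* extended-real valued: the integrand is nonnegative, but need not be
   integrable, since the intensities are not bounded away from 0 *)
Definition kullback_leibler (tau : R) (lam : R -> R -> R) (lamstar : R -> R)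
    (theta : R) : \bar R :=
  (\int[lebesgue_measure]_(t in `[0%R, tau])
    ((lam theta t / lamstar t - 1 - ln (lam theta t / lamstar t))
       * lamstar t)%:E)%E.

(* pseudo-likelihood ratio of the n paths x 0, ..., x n.-1 *)
Definition likelihood (tau : R) (lam : R -> R -> R) (n : nat)
    (x : nat -> cumulative R R) (theta : R) : R :=
  expR (\sum_(j < n)
          \int[lebesgue_stieltjes_measure (x j)]_(t in `]0, tau])
            ln (lam theta t)
        - n%:R * \int[lebesgue_measure]_(t in `[0, tau]) (lam theta t - 1)).

(* One-sided limits taken inside ]al, be[.  At an end point of the interval the
   limit from the outside is given the value 0, so that it plays no role in a
   maximum of nonnegative quantities. *)
Definition rlim_in (be : R) (f : R -> R) (theta : R) : R :=
  if theta < be then lim (f x @[x --> theta^'+]) else 0.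

Definition llim_in (al : R) (f : R -> R) (theta : R) : R :=
  if al < theta then lim (f x @[x --> theta^'-]) else 0.

(* theta ranges over the closed interval: the supremum over ]al, be[ may be
   reached only in the limit at an end point *)
Definition is_mle (al be : R) (f : R -> R) (theta : R) : Prop :=
  theta \in `[al, be] /\
  Num.max (rlim_in be f theta) (llim_in al f theta)
    = sup [set f x | x in `]al, be[].

Definition bayes_estimator (al be : R) (p f : R -> R) : R :=
  (\int[lebesgue_measure]_(x in `]al, be[) (x * p x * f x))
  / (\int[lebesgue_measure]_(x in `]al, be[) (p x * f x)).

Definition cvg_in_probability d (T : measurableType d) (P : probability T R)
    (Y : nat -> T -> R) (c : R) : Prop :=
  forall eps : R, 0 < eps ->
    P [set w | eps <= `|Y n w - c|] @[n --> \oo] --> 0%E.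

End model.

(* Main.v *)
Require Import Defs.
From HB Require Import structures.
From mathcomp Require Import all_boot all_order all_algebra finmap.
From mathcomp Require Import all_classical all_reals all_analysis.
From mathcomp Require Import measurable_realfun ring lra.
Import Order.TTheory GRing.Theory Num.Theory.
Import numFieldNormedType.Exports.

Local Open Scope classical_set_scope.
Local Open Scope ring_scope.

(** Up to a factor that does not depend on theta, the likelihood of n paths is
    exp (n G(theta) - M(theta)), where G(theta) is the integral of g2 - g1 over
    the times before theta and M(theta) is the sum of m = ln (g2 / g1) over the
    jumps before theta [likelihoodE].  The hypothesis on the true intensity
    lamstar says that lamstar m < g2 - g1 before theta0 and lamstar m > g2 - g1
    after theta0.  Hence the expected logarithm of the likelihood increases up
    to theta0 and decreases afterwards.  Applied to the integrand, the same two
    signs give the statement on the Kullback-Leibler distance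
    [kullback_leibler_le].

    Consistency needs this comparison for the observed paths, uniformly in
    theta.  As g1 and g2 may come close to 0, m may be unbounded and the mean of
    M(theta) may be infinite for theta > theta0.  One therefore replaces m by
    m' = min (m, 1 + (g2 - g1) / lamstar) [truncated_ratio]: it does not exceed
    m, agrees with m before theta0, still satisfies m' lamstar > g2 - g1 after
    theta0, and m' lamstar is bounded.  The replacement can only increase
    L(theta) / L(theta0) [jump_log_ratio_le], so that it suffices to control the
    sums of m' over the jumps before theta.

    These sums obey a law of large numbers [poisson_process_lln], which holds in
    mean for every nonnegative f with f lamstar integrable.  For the indicator of
    an interval it is the Chebyshev inequality for Poisson counts; it extends to
    Borel sets by a Dynkin argument and to functions by monotone approximation,
    the error being controlled by the Campbell formula: the mean of the sum of f
    over the jumps is the integral of f lamstar.  Sums and limits are monotone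
    in theta and the limits are Lipschitz, so that convergence on a finite grid
    is uniform.  This yields [likelihood_separation]: outside events of vanishing
    probability, L(theta) <= exp (- c n) L(theta0) for all theta at distance at
    least eps from theta0.

    On the complement of these events, the one-sided limits of L at a point far
    from theta0 stay below L(theta0), so they cannot reach the supremum
    [mle_close].  For the Bayes estimator, the far parameters contribute at most
    exp (- c n) L(theta0) to the numerator, while
    L(theta) >= exp (- C n (theta0 - theta)) L(theta0) for theta <= theta0
    [likelihood_lower], so that the denominator is exponentially larger
    [bayes_estimator_close].  That estimator is a random variable because the
    likelihood is jointly measurable in theta and the paths
    [measurable_bayes_estimator]. *)

(** * Integer-valued measures *)

Section natural_measures.
Set Implicit Arguments.
Unset Strict Implicit.
Context d (Y : measurableType d) (R : realType).
Implicit Types mu : {measure set Y -> \bar R}.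

Definition natural_measure mu :=
  forall U, measurable U -> exists k : nat, mu U = k%:R%:E.

Lemma measurable_ltr_set (f g : Y -> R) :
  measurable_fun setT f -> measurable_fun setT g ->
  measurable [set y | f y < g y].
Proof.
move=> mf mg; have := measurable_fun_ltr mf mg.
by move=> /(_ measurableT [set true]); rewrite setTI; apply.
Qed.

Lemma measurable_ler_set (f g : Y -> R) :
  measurable_fun setT f -> measurable_fun setT g ->
  measurable [set y | f y <= g y].
Proof.
move=> mf mg; have := measurable_fun_ler mf mg.
by move=> /(_ measurableT [set true]); rewrite setTI; apply.
Qed.

Lemma cvg_natural (k : nat -> nat) (l : R) :
  (k n)%:R @[n --> \oo] --> l -> exists m : nat, l = m%:R.
Proof.
move=> kl; have /cvgrPdist_lt/(_ 2^-1) := kl.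
rewrite invr_gt0 ltr0n => /(_ isT)[N _ kN]; exists (k N).
apply: (cvg_unique (@Rhausdorff R) kl); apply: cvg_near_cst; exists N => // n /kN ln.
have lN := kN N (leqnn N); apply/eqP; rewrite eqr_nat.
suff: `|(k n)%:R - (k N)%:R : R| < 1.
  case: (ltngtP (k n) (k N)) => // h.
  - by rewrite distrC -natrB ?(ltnW h)// normr_nat ltrn1 ltnS leqn0 subn_eq0 leqNgt h.
  - by rewrite -natrB ?(ltnW h)// normr_nat ltrn1 ltnS leqn0 subn_eq0 leqNgt h.
have -> : (k n)%:R - (k N)%:R = (l - (k N)%:R) - (l - (k n)%:R) :> R by ring.
have := ler_normB (l - (k N)%:R) (l - (k n)%:R); move: ln lN => /=; lra.
Qed.

(** A Dynkin argument: complements subtract integers, and a convergent sequence of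
    integers has an integer limit. *)
Lemma natural_measure_gen mu (G : set (set Y)) :
  @measurable _ Y = <<s G >> -> setI_closed G ->
  (exists k : nat, mu setT = k%:R%:E) ->
  (forall U, G U -> exists k : nat, mu U = k%:R%:E) ->
  natural_measure mu.
Proof.
move=> GE GI muT muG U mU.
have Tfin : (mu setT < +oo)%E by case: muT => k ->; rewrite ltry.
apply: (@dynkin_induction _ Y G (fun U => exists k : nat, mu U = k%:R%:E));
  rewrite -?GE//.
- move=> S mS [k Sk]; have [K TK] := muT; exists (K - k)%N.
  have kK : (k <= K)%N.
    by rewrite -(ler_nat R) -lee_fin -Sk -TK le_measure ?inE.
  rewrite -setTD measureD// setTI [X in (_ - X)%E]Sk [X in (X - _)%E]TK.
  by rewrite natrB// EFinB.
- move=> F mF tF natF.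
  have /choice[k Fk] := natF.
  have mUF : measurable (\bigcup_k0 F k0) by exact: bigcup_measurable.
  have UFfin : mu (\bigcup_k0 F k0) \is a fin_num.
    by rewrite ge0_fin_numE// (le_lt_trans _ Tfin)// le_measure ?inE.
  have cF : (\sum_(0 <= i < n) mu (F i))%E @[n --> \oo] -->
      (fine (mu (\bigcup_n F n)))%:E.
    by rewrite fineK//; exact: measure_semi_sigma_additive mF tF mUF.
  have /fine_cvgP[_ {}cF] := cF.
  have {}cF : (\sum_(0 <= i < n) k i)%N%:R @[n --> \oo] --> fine (mu (\bigcup_n F n)).
    apply: cvg_trans cF; apply: near_eq_cvg; near=> n.
    by rewrite /= natr_sum (eq_bigr _ (fun i _ => Fk i)) sumEFin.
  by have [m mE] := cvg_natural cF; exists m; rewrite -mE fineK.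
Unshelve. all: by end_near. Qed.

(** The sets [n < `|f|] decrease to the empty set and have integer masses, so one
    of them is null: [f] is essentially bounded.  Sums over the jumps of a
    counting path are thus finite and linear in [f]. *)
Lemma natural_measure_integrable mu (f : Y -> R) : natural_measure mu ->
  measurable_fun setT f -> mu.-integrable setT (EFin \o f).
Proof.
move=> nmu mf.
have Tfin : (mu setT < +oo)%E by have [k ->] := nmu _ measurableT; rewrite ltry.
pose A n := [set y | n%:R < `|f y|].
have mA n : measurable (A n).
  by apply: measurable_ltr_set => //; exact: measurableT_comp.
have A0 : \bigcap_n A n = set0.
  rewrite -subset0 => y /(_ (Num.bound `|f y|) I)/= h.
  by have := archi_boundP (normr_ge0 (f y)); move: h; rewrite /A/=; case: ltgtP.
have cA : mu \o A @ \oo --> 0%E.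
  rewrite -(measure0 mu) -A0; apply: nonincreasing_cvg_mu => //.
  - by rewrite (le_lt_trans _ Tfin)// le_measure ?inE.
  - by rewrite A0.
  - move=> m n mn; apply/subsetPset => y /=; apply: le_lt_trans.
    by rewrite ler_nat.
have [n An] : exists n, mu (A n) = 0%E.
  have /fine_cvgP[_ /cvgrPdist_lt/(_ 1 ltr01)[N _ AN]] := cA.
  exists N; have := AN N (leqnn N).
  have [k Ak] := nmu _ (mA N); rewrite /= Ak sub0r normrN normr_nat ltrn1 ltnS leqn0.
  by move=> /eqP ->.
apply/integrableP; split; first exact/measurable_EFinP.
have mabs : measurable_fun setT (fun x => `|(EFin \o f) x|%E).
  by apply: measurableT_comp => //; exact/measurable_EFinP.
rewrite -(setUv (A n)) ge0_integral_setU//=; last 3 first.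
- exact: measurableC.
- by rewrite setUv.
- by apply/disj_setPS; rewrite setICr.
rewrite (null_set_integral _ _ An)// ?add0e; last first.
  exact: measurable_funTS.
rewrite (@le_lt_trans _ _ (\int[mu]_(x in ~` A n) n%:R%:E)%E)//.
  apply: ge0_le_integral => //.
  - exact: measurableC.
  - by apply: measurable_funTS.
  - by move=> y /negP; rewrite -leNgt lee_fin.
rewrite integral_cst//; last exact: measurableC.
rewrite lte_mul_pinfty// (le_lt_trans _ Tfin)// le_measure ?inE//.
exact: measurableC.
Qed.

End natural_measures.

(** * Nonnegative measurable functions *)

Section nonnegative_induction.
Context d (Y : measurableType d) (R : realType).
Set Implicit Arguments.
Unset Strict Implicit.
Import HBNNSimple.

(** Simple functions, then the monotone approximation of a nonnegative function by
    simple ones. *)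
Lemma nonneg_measurable_ind (Q : (Y -> R) -> Prop) :
  (forall U, measurable U -> Q \1_U) ->
  (forall (c : R) (f : Y -> R), 0 <= c -> measurable_fun setT f -> (forall y, 0 <= f y) ->
    Q f -> Q (fun y => c * f y)) ->
  (forall f g : Y -> R, measurable_fun setT f -> (forall y, 0 <= f y) ->
    measurable_fun setT g -> (forall y, 0 <= g y) ->
    Q f -> Q g -> Q (fun y => f y + g y)) ->
  (forall (F : nat -> Y -> R) (f : Y -> R), (forall n, measurable_fun setT (F n)) ->
    (forall n y, 0 <= F n y) -> (forall y, nondecreasing_seq (F ^~ y)) ->
    measurable_fun setT f -> (forall n y, F n y <= f y) ->
    (forall y, F n y @[n --> \oo] --> f y) -> (forall n, Q (F n)) -> Q f) ->
  forall f : Y -> R, measurable_fun setT f -> (forall y, 0 <= f y) -> Q f.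
Proof.
move=> Qind QZ QD Qlim f mf f0.
have Qsf (g : {nnsfun Y >-> R}) : Q g.
  have -> : (g : Y -> R) = fun y =>
      \sum_(r <- fset_set (range g)) (r * \1_(g @^-1` [set r]) y).
    by apply/funext => y; rewrite {1}(fimfunE g) fsbig_finite.
  have : all (>= 0) (fset_set (range g) : seq R).
    by apply/allP => r; rewrite in_fset_set// inE => -[y _ <-].
  move: (enum_fset (fset_set (range g))) => s; elim: s => [_|r s ih /andP[r0 s0]].
    under eq_fun do rewrite big_nil;
    by have := Qind _ measurable0; rewrite indic0.
  under eq_fun do rewrite big_cons.
  have mr : measurable (g @^-1` [set r]) by [].
  have sge0 y : 0 <= \sum_(i <- s) i * \1_(g @^-1` [set i]) y.
    by rewrite big_seq sumr_ge0// => i /(allP s0) i0; rewrite mulr_ge0.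
  apply: QD => //.
  - exact/measurable_funM/measurable_indic.
  - by move=> y; rewrite mulr_ge0.
  - apply: measurable_sum => i.
    exact/measurable_funM/measurable_indic.
  - by apply: QZ => //; exact: Qind.
  - exact: ih.
have mEf : measurable_fun setT (EFin \o f) by exact/measurable_EFinP.
pose g := nnsfun_approx measurableT mEf.
have gf y : EFin (g n y) @[n --> \oo] --> (f y)%:E.
  by apply: (cvg_nnsfun_approx measurableT mEf) => // z _; rewrite lee_fin f0.
apply: (Qlim (fun n => g n)) => //.
- by move=> y m n mn; exact/lefP/nd_nnsfun_approx.
- move=> n y; rewrite -lee_fin; rewrite /g nnsfun_approxE.
  by apply: le_approx => // z _; rewrite lee_fin.
- by move=> y; have /fine_cvgP[_] := gf y.
Qed.

End nonnegative_induction.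

Section positive_integrals.
Context d (T : measurableType d) (R : realType) (mu : {measure set T -> \bar R}).
Set Implicit Arguments.
Unset Strict Implicit.

(** A nonnegative function of zero integral vanishes almost everywhere. *)
Lemma integral_gt0 (D : set T) (f : T -> R) : measurable D -> (0 < mu D)%E ->
  measurable_fun D f -> (forall x, D x -> 0 < f x) ->
  (0 < \int[mu]_(x in D) (f x)%:E)%E.
Proof.
move=> mD muD mf f0; rewrite lt_neqAle integral_ge0; last first.
  by move=> x Dx; rewrite lee_fin ltW// f0.
rewrite andbT eq_sym; apply/eqP => If.
have If' : (\int[mu]_(x in D) `|(f x)%:E| = 0)%E.
  rewrite -If; apply: eq_integral => x; rewrite inE => Dx.
  by rewrite gee0_abs// lee_fin ltW// f0.
have mEf : measurable_fun D (EFin \o f) by exact/measurable_EFinP.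
have [N [mN N0 DN]] := (ae_eq_integral_abs mu mD mEf).1 If'.
have : (mu D <= mu N)%E.
  rewrite le_measure ?inE// => x Dx; apply: DN => /= /(_ Dx)[] fx0.
  by have := f0 _ Dx; rewrite fx0 ltxx.
by rewrite N0 leNgt muD.
Qed.

End positive_integrals.

(** * Random counting measures and the Campbell formula *)

Section random_counting_measures.
Context d (T : measurableType d) (R : realType) (P : probability T R)
  d' (Y : measurableType d') (N : T -> {measure set Y -> \bar R}).
Set Implicit Arguments.
Unset Strict Implicit.
Hypothesis natN : forall w, natural_measure (N w).

Let Nfin w U : measurable U -> (N w U < +oo)%E.
Proof. by move=> /natN -/(_ w)[k ->]; rewrite ltry. Qed.

Lemma random_measure_gen (G : set (set Y)) :
  @measurable _ Y = <<s G >> -> setI_closed G ->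
  measurable_fun setT (fun w => N w setT) ->
  (forall U, G U -> measurable_fun setT (fun w => N w U)) ->
  forall U, measurable U -> measurable_fun setT (fun w => N w U).
Proof.
move=> GE GI mT mG U mU.
apply: (@dynkin_induction _ Y G (fun U => measurable_fun setT (fun w => N w U)));
  rewrite -?GE//.
- move=> S mS mNS.
  have -> : (fun w => N w (~` S)) = (fun w => N w setT - N w S)%E.
    by apply/funext => w; rewrite -setTD measureD ?setTI// Nfin.
  exact: emeasurable_funB.
- move=> F mF tF mNF.
  have -> : (fun w => N w (\bigcup_k F k)) = (fun w => \sum_(k <oo) N w (F k))%E.
    apply/funext => w; rewrite measure_semi_bigcup//.
    exact: bigcup_measurable.
  exact: ge0_emeasurable_sum.
Qed.

Hypothesis mN : forall U, measurable U -> measurable_fun setT (fun w => N w U).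

Lemma measurable_random_ge0_integral (f : Y -> R) :
  measurable_fun setT f -> (forall y, 0 <= f y) ->
  measurable_fun setT (fun w => \int[N w]_y (f y)%:E)%E.
Proof.
move=> mf f0; apply: (measurable_fun_integral_kernel mN).
  by move=> y; rewrite lee_fin.
exact/measurable_EFinP.
Qed.

(** The integrals of the positive and negative parts are measurable, and the
    real-valued integral is [fine] of their difference. *)
Lemma measurable_random_integral (f : Y -> R) : measurable_fun setT f ->
  measurable_fun setT (fun w => \int[N w]_y f y).
Proof.
move=> mf; have mEf : measurable_fun setT (EFin \o f) by exact/measurable_EFinP.
have mf' : measurable_fun setT (fun w => \int[N w]_y (f y)%:E)%E.
  under eq_fun do rewrite integralE.
  apply: emeasurable_funB; apply: (measurable_fun_integral_kernel mN) => //.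
  - exact: measurable_funepos.
  - exact: measurable_funeneg.
exact: measurableT_comp (fine_measurable measurableT) mf'.
Qed.

Variables (mu : {measure set Y -> \bar R}) (la : Y -> R).
Hypotheses (la0 : forall y, 0 <= la y) (mla : measurable_fun setT la).
Hypothesis la_fin : (\int[mu]_y (la y)%:E < +oo)%E.

Let mEla (U : set Y) : measurable_fun U (EFin \o la).
Proof. by apply: measurable_funTS; exact/measurable_EFinP. Qed.

(** The uniqueness of finite measures that agree on a generating pi-system, applied
    to the mean of the random measure [N]. *)
Lemma mean_measure_gen (G : set (set Y)) :
  @measurable _ Y = <<s G >> -> setI_closed G ->
  (\int[P]_w N w setT = \int[mu]_y (la y)%:E)%E ->
  (forall U, G U -> \int[P]_w N w U = \int[mu]_(y in U) (la y)%:E)%E ->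
  forall U, measurable U ->
    (\int[P]_w N w U = \int[mu]_(y in U) (la y)%:E)%E.
Proof.
move=> GE GI eT eG U mU.
apply: (@dynkin_induction _ Y G
    (fun U => \int[P]_w N w U = \int[mu]_(y in U) (la y)%:E)%E);
  rewrite -?GE//.
- move=> S mS eS; have mCS := measurableC mS.
  have SNfin : (\int[mu]_(y in S) (la y)%:E)%E \is a fin_num.
    rewrite ge0_fin_numE; last by apply: integral_ge0 => y _; rewrite lee_fin.
    by apply: le_lt_trans la_fin; apply: ge0_subset_integral => // y _; rewrite lee_fin.
  rewrite -[LHS](addeK _ SNfin) -[RHS](addeK _ SNfin); congr (_ - _)%E.
  rewrite -[in LHS]eS -ge0_integralD//=; last 2 first.
    exact: mN.
    exact: mN.
  rewrite -ge0_integral_setU//; last 2 first.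
    by move=> y _; rewrite lee_fin.
    by apply/disj_setPS; rewrite setICl.
  rewrite setvU -eT; apply: eq_integral => w _.
  by rewrite -measureU ?setvU// setICl.
- move=> F mF tF eF.
  rewrite ge0_integral_bigcup//; last by move=> y _; rewrite lee_fin.
  under eq_integral.
    move=> w _; rewrite measure_semi_bigcup//; last exact: bigcup_measurable.
    over.
  rewrite integral_nneseries//; last by move=> n; exact: mN.
  exact: eq_eseriesr.
Qed.

Hypothesis meanN : forall U, measurable U ->
  (\int[P]_w N w U = \int[mu]_(y in U) (la y)%:E)%E.

(** For indicators this is the hypothesis on the mean of [N]; both sides are
    additive and commute with increasing limits of nonnegative functions. *)
Lemma campbell (f : Y -> R) : measurable_fun setT f -> (forall y, 0 <= f y) ->
  (\int[P]_w \int[N w]_y (f y)%:E = \int[mu]_y (f y * la y)%:E)%E.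
Proof.
have E0 (g h : Y -> R) : (forall y, 0 <= g y) -> (forall y, 0 <= h y) ->
    forall y, (0 <= (g y * h y)%:E)%E.
  by move=> g0 h0 y; rewrite lee_fin mulr_ge0.
have mE (g : Y -> R) : measurable_fun setT g -> measurable_fun setT (fun y => (g y)%:E).
  by move=> mg; exact/measurable_EFinP.
have mEM (g : Y -> R) : measurable_fun setT g ->
    measurable_fun setT (fun y => (g y * la y)%:E).
  by move=> mg; apply: mE; exact: measurable_funM.
move: f; apply: nonneg_measurable_ind.
- move=> U mU; transitivity (\int[P]_w N w U)%E.
    by apply: eq_integral => w _; rewrite integral_indic ?setIT.
  rewrite meanN// integral_mkcond; apply: eq_integral => y _.
  by rewrite /patch indicE; case: (y \in U); rewrite ?mul1r ?mul0r.
- move=> c f c0 mf f0 ef.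
  transitivity (\int[P]_w (c%:E * \int[N w]_y (f y)%:E))%E.
    apply: eq_integral => w _; rewrite -ge0_integralZl//; first exact: mE.
    by move=> y _; rewrite lee_fin.
  rewrite ge0_integralZl//; last 2 first.
  - exact: measurable_random_ge0_integral.
  - by move=> w _; apply: integral_ge0 => y _; rewrite lee_fin.
  rewrite ef -ge0_integralZl//; last 2 first.
  - exact: mEM.
  - by move=> y _; exact: E0.
  by apply: eq_integral => y _; rewrite -EFinM mulrA.
- move=> f g mf f0 mg g0 ef eg.
  transitivity (\int[P]_w (\int[N w]_y (f y)%:E + \int[N w]_y (g y)%:E))%E.
    apply: eq_integral => w _; rewrite -ge0_integralD//; try exact: mE.
    - by move=> y _; rewrite lee_fin.
    - by move=> y _; rewrite lee_fin.
  rewrite ge0_integralD//; try exact: measurable_random_ge0_integral; last 2 first.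
  - by move=> w _; apply: integral_ge0 => y _; rewrite lee_fin.
  - by move=> w _; apply: integral_ge0 => y _; rewrite lee_fin.
  rewrite ef eg -ge0_integralD//; try exact: mEM; last 2 first.
  - by move=> y _; exact: E0.
  - by move=> y _; exact: E0.
  by apply: eq_integral => y _; rewrite -EFinD mulrDl.
- move=> F f mF F0 ndF mf Ff cF eF.
  have f0 y : 0 <= f y by exact: le_trans (F0 0%N y) (Ff 0%N y).
  have lhs : (\int[P]_w \int[N w]_y (F n y)%:E)%E @[n --> \oo] -->
      (\int[P]_w \int[N w]_y (f y)%:E)%E.
    have -> : (\int[P]_w \int[N w]_y (f y)%:E = \int[P]_w
        limn (fun n => \int[N w]_y (F n y)%:E))%E.
      apply: eq_integral => w _; rewrite -monotone_convergence//.
      + apply: eq_integral => y _; apply/esym/cvg_lim => //.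
        by apply: cvg_EFin; [exact: nearW|exact: cF].
      + by move=> n; exact: mE.
      + by move=> n y _; rewrite lee_fin.
      + by move=> y _ m n mn; rewrite lee_fin ndF.
    apply: cvg_monotone_convergence => //.
    + by move=> n; exact: measurable_random_ge0_integral.
    + by move=> n w _; apply: integral_ge0 => y _; rewrite lee_fin.
    + move=> w _ m n mn; apply: ge0_le_integral => //; try exact: mE.
      * by move=> y _; rewrite lee_fin.
      * by move=> y _; rewrite lee_fin ndF.
  have rhs : (\int[mu]_y (F n y * la y)%:E)%E @[n --> \oo] -->
      (\int[mu]_y (f y * la y)%:E)%E.
    have -> : (\int[mu]_y (f y * la y)%:E = \int[mu]_y
        limn (fun n => (F n y * la y)%:E))%E.
      apply: eq_integral => y _; apply/esym/cvg_lim => //.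
      apply: cvg_EFin; first exact: nearW.
      by apply: cvgM; [exact: cF|exact: cvg_cst].
    apply: cvg_monotone_convergence => //.
    + by move=> n; exact: mEM.
    + by move=> n y _; exact: E0.
    + by move=> y _ m n mn; rewrite lee_fin ler_wpM2r// ndF.
  apply: (cvg_unique _ lhs); first exact: ereal_hausdorff.
  by apply: cvg_trans rhs; apply: near_eq_cvg; apply: nearW => n /=; rewrite eF.
Qed.

End random_counting_measures.

(** * Sums of pairwise independent Poisson counts *)

Section poisson_counts.
Context d (T : measurableType d) (R : realType) (P : probability T R).
Set Implicit Arguments.
Unset Strict Implicit.
Local Open Scope ereal_scope.

Lemma measurable_count (K : T -> nat) (g : nat -> R) :
  (forall k, measurable [set w | K w = k]) ->
  measurable_fun setT (fun w => g (K w)).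
Proof.
move=> mK _ B mB; rewrite setTI.
have -> : (fun w => g (K w)) @^-1` B =
    \bigcup_(k in [set k | B (g k)]) [set w | K w = k].
  by apply/seteqP; split => [w Bw|w [k /= Bk Kk]]; [exists (K w)|rewrite Kk].
exact: bigcup_measurable.
Qed.

Lemma integral_count_fun (K : T -> nat) (g : nat -> R) (D : set T) :
  (forall k, measurable [set w | K w = k]) -> measurable D ->
  (forall k, 0 <= g k)%R ->
  \int[P]_(w in D) (g (K w))%:E =
  \sum_(k <oo) ((g k)%:E * P (D `&` [set w | K w = k])).
Proof.
move=> mK mD g0.
have DE : \bigcup_k (D `&` [set w | K w = k]) = D.
  by apply/seteqP; split => [w [k _ []]//|w Dw]; exists (K w).
have mDK k : measurable (D `&` [set w | K w = k]) by exact: measurableI.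
have mg : measurable_fun setT (fun w => (g (K w))%:E).
  exact/measurable_EFinP/measurable_count.
rewrite -[in LHS]DE ge0_integral_bigcup//.
- apply: eq_eseriesr => k _; rewrite -integral_cst//; apply: eq_integral => w.
  by rewrite inE => -[_ /= Kw]; rewrite -Kw.
- exact: measurable_funTS.
- by move=> w _; rewrite lee_fin.
- apply/trivIsetP => i j _ _ ij; rewrite -subset0 => w [[_ /= Ki] [_ /= Kj]].
  by move: ij; rewrite -Ki -Kj eqxx.
Qed.

Section one_count.
Variables (K : T -> nat) (r : R).
Hypotheses (r0 : (0 < r)%R) (mK : forall k, measurable [set w | K w = k]).
Hypothesis PK : forall k, P [set w | K w = k] = (poisson_pmf r k)%:E.

Let pmfS k : (k.+1%:R * poisson_pmf r k.+1 = r * poisson_pmf r k)%R.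
Proof.
rewrite /poisson_pmf r0 factS exprS natrM invfM.
have k1 : (k.+1%:R != 0 :> R)%R by rewrite pnatr_eq0.
by rewrite -!mulrA mulrCA; congr (_ * _)%R; rewrite mulrCA; congr (_ * _)%R;
  rewrite mulVKf.
Qed.

Let pmf_sum (g : nat -> R) : (forall k, 0 <= g k)%R ->
  \int[P]_w (g (K w))%:E = \sum_(k <oo) (g k * poisson_pmf r k)%:E.
Proof.
move=> g0; rewrite integral_count_fun//.
by apply: eq_eseriesr => k _; rewrite setTI PK EFinM.
Qed.

(** The identity (k + 1) p(k + 1) = r p(k) of Poisson weights, summed against [g].
    Taking g = 1 and g(k) = k gives the first two moments. *)
Let pmf_shift (g : nat -> R) : (forall k, 0 <= g k)%R ->
  \int[P]_w ((K w)%:R * g (K w))%:E = \int[P]_w (r * g (K w).+1)%:E.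
Proof.
move=> g0.
rewrite (pmf_sum (g := fun k => k%:R * g k)%R); last by move=> k; rewrite mulr_ge0.
rewrite (pmf_sum (g := fun k => r * g k.+1)%R); last by move=> k; rewrite mulr_ge0// ltW.
rewrite nneseries_recl//; last first.
  by move=> k _; rewrite lee_fin !mulr_ge0// poisson_pmf_ge0.
rewrite !mul0r add0e -nneseries_addn; last first.
  by move=> k; rewrite lee_fin !mulr_ge0// poisson_pmf_ge0.
apply: eq_eseriesr => k _; congr EFin.
by rewrite addn1 mulrAC pmfS mulrAC.
Qed.

Lemma poisson_mean : \int[P]_w (K w)%:R%:E = r%:E.
Proof.
under eq_integral do rewrite -[((K _)%:R)%R]mulr1.
rewrite (pmf_shift (g := fun=> 1%R))// mulr1.
by rewrite integral_cst//= probability_setT mule1.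
Qed.

Lemma poisson_second_moment :
  \int[P]_w ((K w)%:R * (K w)%:R)%:E = (r * r + r)%:E.
Proof.
rewrite (pmf_shift (g := fun k => k%:R%R))//.
have mKr : measurable_fun setT (fun w => (K w)%:R%:E : \bar R).
  exact/measurable_EFinP/(measurable_count (fun k => k%:R%R : R)).
under eq_integral do rewrite -natr1 mulrDr mulr1 EFinD EFinM.
rewrite ge0_integralD//; last 3 first.
- by move=> w _; rewrite -EFinM lee_fin mulr_ge0// ltW.
- exact: measurable_funeM.
- by move=> w _; rewrite lee_fin ltW.
rewrite ge0_integralZl//; last by rewrite lee_fin ltW.
by rewrite poisson_mean integral_cst//= probability_setT mule1.
Qed.

End one_count.

(** Both sides are double series over the values of the two counts. *)
Lemma indep_counts_mean (K1 K2 : T -> nat) :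
  (forall k, measurable [set w | K1 w = k]) ->
  (forall k, measurable [set w | K2 w = k]) ->
  (forall k l, P ([set w | K1 w = k] `&` [set w | K2 w = l]) =
    P [set w | K1 w = k] * P [set w | K2 w = l]) ->
  \int[P]_w (K2 w)%:R%:E < +oo ->
  \int[P]_w ((K1 w)%:R * (K2 w)%:R)%:E =
  \int[P]_w (K1 w)%:R%:E * \int[P]_w (K2 w)%:R%:E.
Proof.
move=> mK1 mK2 ind fin2.
have m1 := measurable_count (fun k => k%:R%R : R) mK1.
have m2 := measurable_count (fun k => k%:R%R : R) mK2.
have T1 : \bigcup_k [set w | K1 w = k] = setT.
  by apply/seteqP; split => // w _; exists (K1 w).
have fin2' : \int[P]_w (K2 w)%:R%:E = (fine (\int[P]_w (K2 w)%:R%:E))%:E.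
  by rewrite fineK// ge0_fin_numE//; apply: integral_ge0 => w _; rewrite lee_fin.
rewrite [in RHS]fin2' [X in _ = X * _](integral_count_fun (g := fun k => k%:R%R))//.
rewrite muleC -nneseriesZl; last by move=> k _; rewrite mule_ge0.
rewrite -[in LHS]T1 ge0_integral_bigcup//; last 2 first.
- by apply: measurable_funTS; apply/measurable_EFinP; exact: measurable_funM.
- apply/trivIsetP => i j _ _ ij; rewrite -subset0 => w [/= Ki Kj].
  by move: ij; rewrite -Ki -Kj eqxx.
apply: eq_eseriesr => k _; rewrite setTI.
transitivity (\int[P]_(w in [set w | K1 w = k]) (k%:R%:E * (K2 w)%:R%:E)).
  by apply: eq_integral => w; rewrite inE/= => ->; rewrite EFinM.
rewrite ge0_integralZl//; last exact/measurable_EFinP/measurable_funTS.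
rewrite muleCA; congr (_ * _).
rewrite -fin2' (integral_count_fun (g := fun k => k%:R%R))//.
rewrite (integral_count_fun (g := fun k => k%:R%R))//.
rewrite muleC -(fineK (fin_num_measure P _ (mK1 k))) -nneseriesZl; last first.
  by move=> l _; rewrite mule_ge0.
by apply: eq_eseriesr => l _; rewrite setTI ind fineK ?fin_num_measure// muleCA.
Qed.

(** The variance of the sum of the first n counts is n r, and
    |y| <= e / 2 + (e / 2)^-1 y^2 turns this into a bound on the mean absolute
    deviation. *)
Lemma poisson_counts_lln (K : nat -> T -> nat) (r : R) : (0 < r)%R ->
  (forall j k, measurable [set w | K j w = k]) ->
  (forall j k, P [set w | K j w = k] = (poisson_pmf r k)%:E) ->
  (forall i j k l, i != j -> P ([set w | K i w = k] `&` [set w | K j w = l]) =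
    P [set w | K i w = k] * P [set w | K j w = l]) ->
  forall eps, (0 < eps)%R -> \forall n \near \oo,
    \int[P]_w `|n%:R^-1 * (\sum_(j < n) (K j w)%:R) - r|%:E <= eps%:E.
Proof.
move=> r0 mK PK ind.
have mKr j := measurable_count (fun k => k%:R%R : R) (mK j).
pose S n w : R := (\sum_(j < n) (K j w)%:R)%R.
have mS n : measurable_fun setT (S n) by exact: measurable_sum.
have S0 n w : (0 <= S n w)%R by exact: sumr_ge0.
have ES n : \int[P]_w (S n w)%:E = (n%:R * r)%:E.
  under eq_integral do rewrite /S -sumEFin.
  rewrite ge0_integral_sum//; last by move=> j; exact/measurable_EFinP.
  rewrite (eq_bigr (fun=> r%:E)); last first.
    by move=> j _; rewrite (poisson_mean r0 (mK j) (PK j)).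
  by rewrite sumEFin sumr_const card_ord mulr_natl.
have ES2 n : \int[P]_w (S n w * S n w)%:E = (n%:R * r + n%:R * n%:R * (r * r))%:E.
  transitivity (\sum_(i < n) \sum_(j < n) (r * r + (i == j)%:R * r)%:E).
    transitivity (\int[P]_w \sum_(i < n) \sum_(j < n) ((K i w)%:R * (K j w)%:R)%:E).
      apply: eq_integral => w _; rewrite /S mulr_suml -sumEFin.
      by apply: eq_bigr => i _; rewrite mulr_sumr sumEFin.
    rewrite ge0_integral_sum//; last 2 first.
    - move=> i; apply: emeasurable_sum => j.
      by apply/measurable_EFinP; exact: measurable_funM.
    - by move=> i w _; apply: sume_ge0 => j _; rewrite lee_fin.
    apply: eq_bigr => i _; rewrite ge0_integral_sum//; last first.
      by move=> j; apply/measurable_EFinP; exact: measurable_funM.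
    apply: eq_bigr => j _; have [->|ij] := eqVneq i j.
      by rewrite (poisson_second_moment r0 (mK j) (PK j)) mul1r.
    rewrite mul0r addr0 indep_counts_mean//.
    - by rewrite !(poisson_mean r0 (mK _) (PK _)).
    - by move=> k l; exact: ind.
    - by rewrite !(poisson_mean r0 (mK _) (PK _)) ltry.
  under eq_bigr do rewrite sumEFin.
  rewrite sumEFin; congr EFin.
  under eq_bigr do rewrite big_split/= sumr_const card_ord -mulr_suml.
  rewrite big_split/= sumr_const card_ord -mulr_suml addrC; congr (_ + _)%R.
    congr (_ * _)%R; under eq_bigr.
      move=> i _; rewrite (bigD1 i)//= eqxx big1 ?addr0; last first.
        by move=> j ji; rewrite eq_sym (negbTE ji).
      over.
    by rewrite sumr_const card_ord.
  by rewrite -mulrnA -[LHS]mulr_natl natrM.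
have var n : \int[P]_w ((S n w - n%:R * r) ^+ 2)%:E = (n%:R * r)%:E.
  have mdev : measurable_fun setT (fun w => ((S n w - n%:R * r) ^+ 2)%R).
    by apply: measurable_funX; exact: measurable_funB.
  have nr0 : (0 <= n%:R * r)%R by rewrite mulr_ge0// ltW.
  (* All terms of (S - n r)^2 + 2 n r S = S^2 + (n r)^2 are nonnegative, so that the
     integrals add up; the second term is subtracted only after integration. *)
  have key : \int[P]_w ((S n w - n%:R * r) ^+ 2)%:E + (2 * (n%:R * r) * (n%:R * r))%:E
      = (n%:R * r)%:E + (2 * (n%:R * r) * (n%:R * r))%:E.
    transitivity (\int[P]_w (((S n w - n%:R * r) ^+ 2)%:E +
        (2 * (n%:R * r))%:E * (S n w)%:E)).
      rewrite ge0_integralD//; last 4 first.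
      - by move=> w _; rewrite lee_fin sqr_ge0.
      - exact/measurable_EFinP.
      - by move=> w _; rewrite -EFinM lee_fin !mulr_ge0// ltW.
      - by apply: measurable_funeM; exact/measurable_EFinP.
      rewrite ge0_integralZl//; last 3 first.
      - exact/measurable_EFinP.
      - by move=> w _; rewrite lee_fin.
      - by rewrite lee_fin mulr_ge0.
      by rewrite ES -EFinM.
    transitivity (\int[P]_w ((S n w * S n w)%:E + (n%:R * r * (n%:R * r))%:E)).
      by apply: eq_integral => w _; rewrite -EFinM -!EFinD; congr EFin; ring.
    rewrite ge0_integralD//; last 3 first.
    - by move=> w _; rewrite lee_fin mulr_ge0.
    - by apply/measurable_EFinP; exact: measurable_funM.
    - by move=> w _; rewrite lee_fin mulr_ge0.
    rewrite ES2 integral_cst//= probability_setT mule1 -!EFinD; congr EFin; ring.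
  by have := congr1 (fun x => x - (2 * (n%:R * r) * (n%:R * r))%:E) key; rewrite !addeK.
move=> e e0; near=> n.
have n0 : (0 < n%:R :> R)%R by rewrite ltr0n; near: n; exists 1%N.
have e20 : (0 < e / 2)%R by rewrite divr_gt0.
pose c : R := ((e / 2)^-1 * (n%:R ^- 2))%R.
have c0 : (0 <= c)%R by rewrite /c mulr_ge0// ?invr_ge0 ?exprn_ge0// ltW.
have mdev : measurable_fun setT (fun w => ((S n w - n%:R * r) ^+ 2)%R).
  by apply: measurable_funX; exact: measurable_funB.
apply: (@le_trans _ _ (\int[P]_w ((e / 2)%:E + c%:E * ((S n w - n%:R * r) ^+ 2)%:E))).
  apply: ge0_le_integral => //.
  - apply/measurable_EFinP; apply: measurableT_comp => //.
    by apply: measurable_funB => //; apply: measurable_funM => //; exact: mS.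
  - apply: emeasurable_funD => //; apply: measurable_funeM.
    exact/measurable_EFinP.
  - move=> w _; rewrite -EFinM -EFinD lee_fin -/(S n w).
    have -> : (n%:R^-1 * S n w - r = n%:R^-1 * (S n w - n%:R * r))%R.
      by field; rewrite gt_eqF.
    set y := (S n w - n%:R * r)%R.
    have -> : (c * y ^+ 2 = (e / 2)^-1 * `|n%:R^-1 * y| ^+ 2)%R.
      by rewrite real_normK ?num_real// /c exprMn exprVn [RHS]mulrA.
    set z := (`|_|)%R; have z0 : (0 <= z)%R by exact: normr_ge0.
    have [ze|ze] := lerP z (e / 2).
      by rewrite (le_trans ze)// lerDl mulr_ge0// ?invr_ge0 ?exprn_ge0 ?(ltW e20).
    rewrite (@le_trans _ _ ((e / 2)^-1 * z ^+ 2)%R)//; last by rewrite lerDr ltW.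
    by rewrite ler_pdivlMl// expr2 ler_wpM2r// ltW.
rewrite ge0_integralD//; last 3 first.
- by move=> w _; rewrite lee_fin ltW.
- by move=> w _; rewrite -EFinM lee_fin mulr_ge0// sqr_ge0.
- by apply: measurable_funeM; exact/measurable_EFinP.
rewrite integral_cst//= probability_setT mule1 ge0_integralZl//; last 2 first.
- exact/measurable_EFinP.
- by move=> w _; rewrite lee_fin sqr_ge0.
rewrite var -EFinM -EFinD lee_fin.
suff : (c * (n%:R * r) <= e / 2)%R by lra.
have -> : (c * (n%:R * r) = (e / 2)^-1 * (r / n%:R))%R.
  by rewrite /c; field; rewrite !gt_eqF.
rewrite ler_pdivrMl// ler_pdivrMr//.
rewrite -ler_pdivrMl; last by rewrite mulr_gt0.
by near: n; exact: nbhs_infty_ger.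
Unshelve. all: by end_near. Qed.

End poisson_counts.

(** * A law of large numbers for random counting measures *)

Section law_of_large_numbers.
Context d (T : measurableType d) (R : realType) (P : probability T R)
  d' (Y : measurableType d') (mu : {measure set Y -> \bar R}) (la : Y -> R)
  (N : nat -> T -> {measure set Y -> \bar R}).
Set Implicit Arguments.
Unset Strict Implicit.

Definition empirical_mean (n : nat) (f : Y -> R) (w : T) : R :=
  n%:R^-1 * \sum_(j < n) \int[N j w]_y f y.

(** The distance in mean between the empirical mean of [f] and its theoretical
    value, extended-real as the integral of a nonnegative function. *)
Definition mean_deviation (n : nat) (f : Y -> R) : \bar R :=
  (\int[P]_w `|empirical_mean n f w - \int[mu]_y (f y * la y)|%:E)%E.

(** Convergence in mean of the empirical means.  The inductive wrapper makes the
    comparison of two instances a comparison of the functions only. *)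
Variant mean_lln (f : Y -> R) : Prop := MeanLLN of
  forall e, 0 < e -> \forall n \near \oo, (mean_deviation n f <= e%:E)%E.

Definition mean_integrable (f : Y -> R) :=
  mu.-integrable setT (EFin \o (fun y => f y * la y)).

Hypothesis natN : forall j w, natural_measure (N j w).
Hypothesis mN : forall j U, measurable U ->
  measurable_fun setT (fun w => N j w U).
Hypotheses (la0 : forall y, 0 <= la y) (mla : measurable_fun setT la).
Hypothesis la_fin : (\int[mu]_y (la y)%:E < +oo)%E.
Hypothesis meanN : forall j U, measurable U ->
  (\int[P]_w N j w U = \int[mu]_(y in U) (la y)%:E)%E.

Implicit Types f g : Y -> R.

Let iN j w f : measurable_fun setT f ->
  (N j w).-integrable setT (EFin \o f).
Proof. by move=> mf; exact: natural_measure_integrable. Qed.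

Lemma measurable_empirical_mean n f : measurable_fun setT f ->
  measurable_fun setT (empirical_mean n f).
Proof.
move=> mf; apply: measurable_funM => //; apply: measurable_sum => j.
exact: (measurable_random_integral (mN j)).
Qed.

Lemma empirical_meanD n f g w :
  measurable_fun setT f -> measurable_fun setT g ->
  empirical_mean n (fun y => f y + g y) w =
  empirical_mean n f w + empirical_mean n g w.
Proof.
move=> mf mg; rewrite /empirical_mean -mulrDr -big_split/=; congr (_ * _).
by apply: eq_bigr => j _; rewrite RintegralD//; exact: iN.
Qed.

Lemma empirical_meanZ n c f w : measurable_fun setT f ->
  empirical_mean n (fun y => c * f y) w = c * empirical_mean n f w.
Proof.
move=> mf; rewrite /empirical_mean [RHS]mulrCA; congr (_ * _); rewrite mulr_sumr.
by apply: eq_bigr => j _; rewrite RintegralZl//; exact: iN.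
Qed.

Lemma le_empirical_mean n f g w :
  measurable_fun setT f -> measurable_fun setT g -> (forall y, f y <= g y) ->
  empirical_mean n f w <= empirical_mean n g w.
Proof.
move=> mf mg fg; apply: ler_wpM2l; first by rewrite invr_ge0.
apply: ler_sum => j _.
by apply: le_Rintegral => //; exact: iN.
Qed.

(** The Campbell formula; an inequality, because the empirical mean over no
    observation is 0. *)
Lemma integral_empirical_mean n f :
  measurable_fun setT f -> (forall y, 0 <= f y) ->
  (\int[P]_w (empirical_mean n f w)%:E <= \int[mu]_y (f y * la y)%:E)%E.
Proof.
move=> mf f0; rewrite /empirical_mean.
have I0 j w : 0 <= \int[N j w]_y f y by apply: Rintegral_ge0.
have mI j : measurable_fun setT (fun w => \int[N j w]_y f y).
  exact: (measurable_random_integral (mN j)).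
have E0 : (0 <= \int[mu]_y (f y * la y)%:E)%E.
  by apply: integral_ge0 => y _; rewrite lee_fin mulr_ge0.
rewrite (eq_integral (fun w => (n%:R^-1)%:E *
    \sum_(j < n) (\int[N j w]_y f y)%:E)%E); last first.
  by move=> w _; rewrite sumEFin -EFinM.
rewrite ge0_integralZl//; last 2 first.
- by apply: emeasurable_sum => j; exact/measurable_EFinP.
- by move=> w _; apply: sume_ge0 => j _; rewrite lee_fin.
rewrite ge0_integral_sum//; last 2 first.
- by move=> j; exact/measurable_EFinP.
- by move=> j w _; rewrite lee_fin.
rewrite (eq_bigr (fun=> \int[mu]_y (f y * la y)%:E)%E); last first.
  move=> j _; rewrite -(campbell (mN j) la0 mla (meanN j) mf f0).
  apply: eq_integral => w _; rewrite /Rintegral fineK//.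
  exact: integrable_fin_num (iN j w mf).
case: n => [|n]; first by rewrite big_ord0 mule0.
move: E0; case: (integral _ _ _) => [r||]// E0; last by rewrite leey.
by rewrite sumEFin sumr_const card_ord -EFinM -(mulr_natl r) mulKf.
Qed.

Let mean_integrableB f g : mean_integrable f -> mean_integrable g ->
  mean_integrable (fun y => f y - g y).
Proof.
move=> intf intg; have := integrableB measurableT intf intg.
apply: eq_integrable => // y _.
by rewrite /= -EFinB mulrBl.
Qed.

Lemma mean_integrable_measurable f : measurable_fun setT f ->
  (\int[mu]_y (`|f y| * la y)%:E < +oo)%E -> mean_integrable f.
Proof.
move=> mf ffin; apply/integrableP; split.
  by apply/measurable_EFinP; exact: measurable_funM.
apply: le_lt_trans ffin; apply: ge0_le_integral => //.
- apply/measurable_EFinP; apply: measurableT_comp => //.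
  exact: measurable_funM.
- apply/measurable_EFinP; apply: measurable_funM => //.
  exact: measurableT_comp.
- by move=> y _; rewrite lee_fin normrM (ger0_norm (la0 y)).
Qed.

Lemma mean_integrable_le f g : measurable_fun setT f ->
  mean_integrable g -> (forall y, `|f y| <= g y) -> mean_integrable f.
Proof.
move=> mf ig fg; apply: le_integrable ig => //.
  by apply/measurable_EFinP; exact: measurable_funM.
move=> y _ /=; rewrite lee_fin !normrM ler_wpM2r//.
by rewrite (le_trans (fg y))// ler_norm.
Qed.

Lemma mean_integrable_indic U : measurable U -> mean_integrable \1_U.
Proof.
move=> mU; apply: mean_integrable_measurable => //.
apply: le_lt_trans la_fin; apply: ge0_le_integral => //.
- by move=> y _; rewrite lee_fin mulr_ge0.
- apply/measurable_EFinP; apply: measurable_funM => //.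
  exact: measurableT_comp.
- exact/measurable_EFinP.
- move=> y _; rewrite lee_fin indicE; case: (y \in U) => /=.
    by rewrite normr1 mul1r.
  by rewrite normr0 mul0r.
Qed.

Let mdev n f : measurable_fun setT f -> measurable_fun setT
  (fun w => `|empirical_mean n f w - \int[mu]_y (f y * la y)|%:E).
Proof.
move=> mf; apply/measurable_EFinP; apply: measurableT_comp => //.
by apply: measurable_funB => //; exact: measurable_empirical_mean.
Qed.

(** The empirical means of [f] and [g] differ by at most the empirical mean of
    [`|f - g|], which has the same expectation as the theoretical difference.
    This is what makes the law of large numbers stable under approximation. *)
Lemma mean_deviation_le n f g : measurable_fun setT f -> measurable_fun setT g ->
  mean_integrable f -> mean_integrable g ->
  (mean_deviation n f <=
    mean_deviation n g + 2%:E * \int[mu]_y (`|f y - g y| * la y)%:E)%E.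
Proof.
move=> mf mg intf intg.
have mfg : measurable_fun setT (fun y => f y - g y) by exact: measurable_funB.
have mafg : measurable_fun setT (fun y => `|f y - g y|) by exact: measurableT_comp.
have intfg := mean_integrableB intf intg.
pose D := \int[mu]_y (`|f y - g y| * la y).
have DE : (\int[mu]_y (`|f y - g y| * la y)%:E = D%:E)%E.
  rewrite /D /Rintegral fineK//.
  have := integrable_fin_num measurableT (integrable_abse intfg).
  rewrite (eq_integral (fun y => (`|f y - g y| * la y)%:E))// => y _.
  by rewrite /= normrM (ger0_norm (la0 y)).
have D0 : 0 <= D by apply: Rintegral_ge0 => y _; rewrite mulr_ge0.
have LfLg : `|\int[mu]_y (f y * la y) - \int[mu]_y (g y * la y)| <= D.
  rewrite -RintegralB//.
  under eq_Rintegral do rewrite -mulrBl.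
  rewrite (le_trans (le_normr_Rintegral _ intfg))//.
  rewrite le_eqVlt; apply/orP; left; apply/eqP; apply: eq_Rintegral => y _.
  by rewrite /= normrM (ger0_norm (la0 y)).
have ptw w : `|empirical_mean n f w - \int[mu]_y (f y * la y)| <=
    `|empirical_mean n g w - \int[mu]_y (g y * la y)| +
    (empirical_mean n (fun y => `|f y - g y|) w + D).
  have : `|empirical_mean n f w - empirical_mean n g w| <=
      empirical_mean n (fun y => `|f y - g y|) w.
    have -> : empirical_mean n f w =
        empirical_mean n (fun y => f y - g y) w + empirical_mean n g w.
      rewrite -empirical_meanD//; congr empirical_mean.
      by apply/funext => y; rewrite subrK.
    rewrite addrK ler_norml; apply/andP; split.
      rewrite lerNl -mulN1r -empirical_meanZ//.
      apply: le_empirical_mean => //; first exact: measurable_funM.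
      by move=> y; rewrite mulN1r -normrN ler_norm.
    by apply: le_empirical_mean => // y; exact: ler_norm.
  move: LfLg.
  set a := empirical_mean n f w; set b := empirical_mean n g w.
  set x := \int[mu]_y (f y * la y); set y := \int[mu]_y (g y * la y).
  set z := empirical_mean _ _ _ => xy ab.
  have -> : a - x = (b - y) + (a - b) + (y - x) by ring.
  apply: (le_trans (ler_normD _ _)); rewrite [leRHS]addrA.
  apply: lerD; last by rewrite distrC.
  by apply: (le_trans (ler_normD _ _)); rewrite lerD.
have E0 w : 0 <= empirical_mean n (fun y => `|f y - g y|) w.
  rewrite mulr_ge0// sumr_ge0// => j _.
  by apply: Rintegral_ge0.
have mE := measurable_empirical_mean n mafg.
apply: (@le_trans _ _ (\int[P]_w
    (`|empirical_mean n g w - \int[mu]_y (g y * la y)|%:E +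
    ((empirical_mean n (fun y => `|f y - g y|%R) w)%:E + D%:E)))%E).
  apply: ge0_le_integral => //.
  - exact: mdev.
  - apply: emeasurable_funD; first exact: mdev.
    by apply: emeasurable_funD => //; exact/measurable_EFinP.
  - by move=> w _; rewrite -!EFinD lee_fin ptw.
rewrite ge0_integralD//; last 3 first.
- exact: mdev.
- by move=> w _; rewrite adde_ge0 ?lee_fin.
- by apply: emeasurable_funD => //; exact/measurable_EFinP.
rewrite leeD2l// ge0_integralD//; last 2 first.
- by move=> w _; rewrite lee_fin.
- exact/measurable_EFinP.
rewrite integral_cst//= probability_setT mule1.
have := @integral_empirical_mean n _ mafg (fun y => normr_ge0 _).
rewrite DE => ED.
have -> : (2%:E * D%:E = D%:E + D%:E)%E by rewrite -EFinM -EFinD mulr2n mulrDl mul1r.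
exact: leeD.
Qed.

Lemma mean_lln_approx f : measurable_fun setT f -> mean_integrable f ->
  (forall e, 0 < e -> exists g, [/\ measurable_fun setT g, mean_integrable g,
     mean_lln g & (\int[mu]_y (`|f y - g y| * la y)%:E <= e%:E)%E]) ->
  mean_lln f.
Proof.
move=> mf intf approx; split=> e e0.
have e40 : 0 < e / 4 by rewrite divr_gt0.
have e20 : 0 < e / 2 by rewrite divr_gt0.
have [g [mg intg [llng] fg]] := approx _ e40.
apply: filterS (llng _ e20) => n dg.
apply: (le_trans (mean_deviation_le n mf mg intf intg)).
have -> : e%:E = ((e / 2)%:E + 2%:E * (e / 4)%:E)%E.
  by rewrite -EFinM -EFinD; congr EFin; field.
by rewrite leeD// lee_wpmul2l.
Qed.

Lemma mean_llnD f g : measurable_fun setT f -> measurable_fun setT g ->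
  mean_integrable f -> mean_integrable g ->
  mean_lln f -> mean_lln g -> mean_lln (fun y => f y + g y).
Proof.
move=> mf mg intf intg [llnf] [llng]; split=> e e0.
have e20 : 0 < e / 2 by rewrite divr_gt0.
apply: filterS2 (llnf _ e20) (llng _ e20) => n df dg.
have -> : e%:E = ((e / 2)%:E + (e / 2)%:E)%E by rewrite -EFinD; congr EFin; field.
rewrite (le_trans _ (leeD df dg))// /mean_deviation -ge0_integralD//; last 2 first.
- exact: mdev.
- exact: mdev.
apply: ge0_le_integral => //.
- by apply: mdev; exact: measurable_funD.
- by apply: emeasurable_funD; exact: mdev.
move=> w _; rewrite -EFinD lee_fin empirical_meanD//.
under eq_Rintegral do rewrite mulrDl.
rewrite RintegralD//.
by rewrite opprD addrACA ler_normD.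
Qed.

Lemma mean_llnZ c f : measurable_fun setT f -> mean_integrable f ->
  mean_lln f -> mean_lln (fun y => c * f y).
Proof.
move=> mf intf [llnf]; split=> e e0.
have e20 : 0 < e / (`|c| + 1) by rewrite divr_gt0// ltr_wpDl.
apply: filterS (llnf _ e20) => n df.
have -> : mean_deviation n (fun y => c * f y) = (`|c|%:E * mean_deviation n f)%E.
  rewrite /mean_deviation -ge0_integralZl//; last exact: mdev.
  apply: eq_integral => w _; rewrite empirical_meanZ//.
  under eq_Rintegral do rewrite -mulrA.
  by rewrite RintegralZl// -mulrBr normrM EFinM.
rewrite (le_trans (lee_wpmul2l _ df))// -EFinM lee_fin.
by rewrite mulrCA ler_piMr ?(ltW e0)// ler_pdivrMr ?mul1r ?lerDl// ltr_wpDl.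
Qed.

(** Dominated convergence gives the convergence of [F n] to [f] in mean with respect
    to the intensity. *)
Lemma mean_lln_nondecreasing (F : nat -> Y -> R) f :
  (forall n, measurable_fun setT (F n)) -> measurable_fun setT f ->
  (forall n y, 0 <= F n y <= f y) -> mean_integrable f ->
  (forall y, F n y @[n --> \oo] --> f y) ->
  (forall n, mean_lln (F n)) -> mean_lln f.
Proof.
move=> mF mf Ff intf cF llnF.
have f0 y : 0 <= f y by have /andP[/le_trans] := Ff 0%N y; apply.
have intF n : mean_integrable (F n).
  apply: (mean_integrable_le _ intf) => // y.
  by have /andP[F0 Fle] := Ff n y; rewrite ger0_norm.
apply: mean_lln_approx => // e e0.
have mEM g : measurable_fun setT g ->
    measurable_fun setT (fun y => (g y * la y)%:E).
  by move=> mg; apply/measurable_EFinP; exact: measurable_funM.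
have cv : {ae mu, forall y, setT y ->
    (fun n => (F n y * la y)%:E) n @[n --> \oo] --> (f y * la y)%:E}.
  apply: aeW => y _; apply: cvg_EFin; first exact: nearW.
  by apply: cvgM; [exact: cF|exact: cvg_cst].
have dom : {ae mu, forall y n, setT y -> (`|(F n y * la y)%:E| <= (f y * la y)%:E)%E}.
  apply: aeW => y n _; have /andP[F0 Fle] := Ff n y.
  by rewrite lee_fin ger0_norm ?mulr_ge0// ler_wpM2r.
have [_ + _] := dominated_convergence measurableT (fun n => mEM _ (mF n))
  (mEM _ mf) cv intf dom.
move=> /fine_cvgP[fin /cvgrPdist_le/(_ _ e0) small].
have [n [finn smalln]] : exists n,
    (\int[mu]_y `|(F n y * la y)%:E - (f y * la y)%:E|)%E \is a fin_num /\
    `|0 - fine (\int[mu]_y `|(F n y * la y)%:E - (f y * la y)%:E|)%E| <= e.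
  by have [n _ /(_ n (leqnn n))] := filterI fin small; exists n.
exists (F n); split => //.
move: smalln; rewrite sub0r normrN -lee_fin -fine_abse// fineK ?abse_fin_num//.
rewrite gee0_abs; last by apply: integral_ge0 => y _; exact: abse_ge0.
apply: le_trans; rewrite le_eqVlt; apply/orP; left; apply/eqP.
apply: eq_integral => y _; rewrite -EFinB abse_EFin -mulrBl normrM.
by rewrite (ger0_norm (la0 y)) distrC.
Qed.

(** A Dynkin argument; a countable disjoint union is the increasing limit of its
    finite subunions. *)
Lemma mean_lln_gen (G : set (set Y)) :
  @measurable _ Y = <<s G >> -> setI_closed G ->
  mean_lln \1_setT -> (forall U, G U -> mean_lln \1_U) ->
  forall U, measurable U -> mean_lln \1_U.
Proof.
move=> GE GI llnT llnG.
have llnC S : measurable S -> mean_lln \1_S -> mean_lln \1_(~` S).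
  move=> mS llnS.
  have -> : \1_(~` S) = (fun y => \1_setT y + -1 * \1_S y) :> (Y -> R).
    apply/funext => y; rewrite !indicE in_setT in_setC.
    by case: (y \in S) => /=; rewrite ?mulr1 ?subrr ?mulr0 ?addr0.
  have intS := mean_integrable_indic mS.
  have mS' : measurable_fun setT (fun y => -1 * \1_S y : R).
    exact/measurable_funM/measurable_indic.
  apply: mean_llnD => //.
  - exact: mean_integrable_indic.
  - apply: (mean_integrable_le mS' intS) => y.
    by rewrite mulN1r normrN indicE; case: (y \in S); rewrite ?normr1 ?normr0.
  - exact: mean_llnZ.
have llnU (F : (set Y)^nat) : (forall n, measurable (F n)) ->
    trivIset setT F -> (forall n, mean_lln \1_(F n)) ->
    mean_lln \1_(\bigcup_k F k).
  move=> mF tF llnF.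
  pose S n y : R := \sum_(k < n) \1_(F k) y.
  have mS n : measurable_fun setT (S n).
    by apply: measurable_sum => k; exact: measurable_indic.
  have mUF : measurable (\bigcup_k F k) by exact: bigcup_measurable.
  have S_out n y : (forall k : nat, (k < n)%N -> ~ F k y) -> S n y = 0.
    move=> Fy; rewrite /S big1// => k _; rewrite indicE memNset//.
    exact: Fy (ltn_ord k).
  have S_in n y k : F k y -> S n y = (k < n)%N%:R.
    move=> Fky; have [kn|kn] := ltnP k n; last first.
      apply: S_out => i ik Fiy.
      have ki : i = k.
        by apply: (tF i k) => //; exists y.
      by move: ik; rewrite ki ltnNge kn.
    rewrite /S (bigD1 (Ordinal kn))//= indicE mem_set// big1 ?addr0// => i ik.
    rewrite indicE memNset// => Fiy; move/eqP: ik; apply; apply: val_inj => /=.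
    by apply: (tF i k) => //; exists y.
  have ind_le n y : 0 <= S n y <= \1_(\bigcup_k F k) y.
    have [[k _ Fky]|nF] := pselect ((\bigcup_k F k) y).
      by rewrite (S_in n y k)// indicE mem_set//; [rewrite ler0n lern1 leq_b1|exists k].
    rewrite S_out ?lexx//= => k _ Fky.
    by apply: nF; exists k.
  apply: (@mean_lln_nondecreasing S) => //.
  - exact: mean_integrable_indic.
  - move=> y; have [[k _ Fky]|nF] := pselect ((\bigcup_k F k) y).
      apply: cvg_near_cst; exists k.+1 => // n /= kn.
      rewrite (S_in n y k)// kn indicE mem_set//; by exists k.
    apply: cvg_near_cst; apply: nearW => n.
    rewrite S_out; last by move=> k _ Fky; apply: nF; exists k.
    by rewrite indicE memNset.
  - elim => [|n ih].
      have -> : S 0%N = (fun y => 0 * \1_setT y).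
        by apply/funext => y; rewrite /S big_ord0 mul0r.
      by apply: mean_llnZ => //; exact: mean_integrable_indic.
    have -> : S n.+1 = (fun y => S n y + \1_(F n) y).
      by apply/funext => y; rewrite /S big_ord_recr.
    apply: mean_llnD => //; last exact: mean_integrable_indic.
    apply: (mean_integrable_le (mS n) (mean_integrable_indic mUF)) => y.
    by have /andP[S0 SU] := ind_le n y; rewrite ger0_norm.
move=> U mU; have := @dynkin_induction _ Y G (fun U => mean_lln \1_U) GE GI
  llnT llnG llnC llnU U.
by apply; rewrite -GE.
Qed.

Theorem mean_lln_ge0 (G : set (set Y)) :
  @measurable _ Y = <<s G >> -> setI_closed G ->
  mean_lln \1_setT -> (forall U, G U -> mean_lln \1_U) ->
  forall f, measurable_fun setT f -> (forall y, 0 <= f y) ->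
  mean_integrable f -> mean_lln f.
Proof.
move=> GE GI llnT llnG; apply: nonneg_measurable_ind.
- by move=> U mU _; apply: (mean_lln_gen GE GI).
- move=> c f c0 mf f0 llnf intcf.
  have [->|cn0] := eqVneq c 0.
    have -> : (fun y => 0 * f y) = (fun y => 0 * \1_setT y).
      by apply/funext => y; rewrite !mul0r.
    by apply: mean_llnZ => //; exact: mean_integrable_indic.
  have intf : mean_integrable f.
    have := integrableZl measurableT c^-1 intcf.
    apply: eq_integrable => // y _.
    by rewrite /= -EFinM !mulrA mulVf// mul1r.
  by apply: mean_llnZ => //; exact: llnf.
- move=> f g mf f0 mg g0 llnf llng intfg.
  have intf : mean_integrable f.
    by apply: (mean_integrable_le mf intfg) => y; rewrite ger0_norm// lerDl.
  have intg : mean_integrable g.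
    by apply: (mean_integrable_le mg intfg) => y; rewrite ger0_norm// lerDr.
  by apply: mean_llnD => //; [exact: llnf|exact: llng].
- move=> F f mF F0 ndF mf Ff cF llnF intf.
  apply: (mean_lln_nondecreasing mF) => //.
    by move=> n y; rewrite F0 Ff.
  move=> n; apply: llnF; apply: (mean_integrable_le (mF n) intf) => y.
  by rewrite ger0_norm.
Qed.

End law_of_large_numbers.

(** * The jump measure of a counting path *)

Section jump_measures.
Context (R : realType) (tau : R).
Set Implicit Arguments.
Unset Strict Implicit.

(** The Lebesgue-Stieltjes measure restricted to the observation window, outside
    of which nothing is known about a path. *)
Definition jump_measure (x : cumulative R R) :
    {measure set (measurableTypeR R) -> \bar R} :=
  mrestr (lebesgue_stieltjes_measure x)
    (measurable_itv `]0, tau] : measurable (`]0, tau]%classic : set (measurableTypeR R))).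

Lemma lebesgue_stieltjes_itvoc (x : cumulative R R) (a b : R) : a <= b ->
  lebesgue_stieltjes_measure x `]a, b] = (x b - x a)%:E.
Proof.
move=> ab; rewrite /lebesgue_stieltjes_measure /measure_extension/=.
by rewrite measurable_mu_extE/= ?wlength_itv_bnd//; exact: is_ocitv.
Qed.

Lemma measurable_open_rays :
  @measurable _ (measurableTypeR R) = <<s @RGenOInfty.G R >>.
Proof. exact: RGenOInfty.measurableE. Qed.

Lemma setI_closed_open_rays : setI_closed (@RGenOInfty.G R).
Proof.
move=> _ _ [x ->] [y ->]; exists (Num.max x y).
by apply/seteqP; split => z /=; rewrite !in_itv/= !andbT gt_max => /andP.
Qed.

Hypothesis tau0 : 0 < tau.

(** The ray above [c] meets the window in the interval from [clamp c] to [tau]. *)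
Definition clamp (c : R) := Num.min tau (Num.max 0 c).

Lemma clamp_itv c : clamp c \in `[0, tau].
Proof. by rewrite in_itv/= /clamp le_min ge_min lexx (ltW tau0) le_max lexx. Qed.

Lemma setI_itv_clamp c : `]c, +oo[ `&` `]0, tau] = `](clamp c), tau]%classic.
Proof.
apply/seteqP; split => z /=; rewrite !in_itv/= ?andbT /clamp gt_min gt_max.
  by move=> [cz /andP[z0 ->]]; rewrite z0 cz orbT.
move=> /andP[/orP[tz|/andP[-> ->]] ztau]; last by rewrite ztau.
by move: tz; rewrite ltNge ztau.
Qed.

Lemma jump_measure_itv (x : cumulative R R) (c : R) :
  jump_measure x `]c, +oo[%classic = (x tau - x (clamp c))%:E.
Proof.
transitivity (lebesgue_stieltjes_measure x `](clamp c), tau]).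
  rewrite /jump_measure/= /mrestr; congr (lebesgue_stieltjes_measure x _).
  exact: setI_itv_clamp.
rewrite lebesgue_stieltjes_itvoc//.
by have := clamp_itv c; rewrite in_itv => /andP[].
Qed.

Lemma jump_measure_setT x : jump_measure x setT = (x tau - x 0)%:E.
Proof.
transitivity (lebesgue_stieltjes_measure x `]0, tau]).
  rewrite /jump_measure/= /mrestr; congr (lebesgue_stieltjes_measure x _).
  exact: setTI.
by rewrite lebesgue_stieltjes_itvoc// ltW.
Qed.

Definition counting_path (x : cumulative R R) :=
  forall t, t \in `[0, tau] -> x t \is a Num.nat.

Lemma counting_path_increment x s t : counting_path x ->
  0 <= s -> s <= t -> t <= tau -> x t - x s = (Num.truncn (x t - x s))%:R.
Proof.
move=> xn s0 st ttau.
have /natrP[k xs] : x s \is a Num.nat by apply: xn; rewrite in_itv/= s0 (le_trans st).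
have /natrP[l xt] : x t \is a Num.nat by apply: xn; rewrite in_itv/= ttau (le_trans s0).
have : x s <= x t by exact: cumulative_is_nondecreasing.
by rewrite xs xt ler_nat => kl; rewrite -natrB// natrK.
Qed.

Lemma natural_jump_measure x : counting_path x -> natural_measure (jump_measure x).
Proof.
move=> xn; apply: (natural_measure_gen measurable_open_rays setI_closed_open_rays).
  rewrite jump_measure_setT (counting_path_increment xn)//; last exact: ltW.
  by eexists.
move=> _ [c ->]; rewrite jump_measure_itv.
have := clamp_itv c; rewrite in_itv/= => /andP[c0 ctau].
by rewrite (counting_path_increment xn)//; eexists.
Qed.

Lemma jump_integral (x : cumulative R R) (f : R -> R) :
  \int[lebesgue_stieltjes_measure x]_(t in `]0, tau]) f t =
  \int[jump_measure x]_t (f \_ `]0, tau]) t.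
Proof.
rewrite -Rintegral_mkcond /Rintegral; congr fine; apply: eq_measure_integral => A mA AD.
by rewrite /= /mrestr setIidl.
Qed.

End jump_measures.

(** * The law of large numbers for Poisson processes *)

Section poisson_process_lln.
Context (R : realType) (tau : R) d (T : measurableType d) (P : probability T R).
Set Implicit Arguments.
Unset Strict Implicit.
Variables (ls : R -> R) (X : nat -> T -> cumulative R R).
Hypothesis tau0 : 0 < tau.
Hypothesis mls : measurable_fun `[0, tau] ls.
Hypothesis bls : [bounded ls t : R^o | t in `[0, tau]].
Hypothesis ls0 : forall t, t \in `[0, tau] -> 0 < ls t.
Hypothesis ppX : forall j, poisson_process P tau ls (X j).
Hypothesis indX : independent_processes P tau X.

(** The intensity extended by 0, so that all integrals run over the whole line. *)
Definition restricted_intensity : measurableTypeR R -> R := ls \_ `]0, tau].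
Local Notation la := restricted_intensity.
Local Notation leb := (@lebesgue_measure R).

Let ls_ge0 t : t \in `[0, tau] -> 0 <= ls t.
Proof. by move=> /ls0/ltW. Qed.

Let sub_oc (c : R) : 0 <= c -> `]c, tau] `<=` `[0, tau].
Proof.
by move=> c0 t /=; rewrite !in_itv/= => /andP[ct ->]; rewrite (le_trans c0)// ltW.
Qed.

Lemma restricted_intensity_ge0 t : 0 <= la t.
Proof.
rewrite /la /patch; case: ifPn => //; rewrite inE => /(sub_oc (lexx 0)) tI.
exact: ls_ge0.
Qed.

Lemma measurable_restricted_intensity : measurable_fun setT la.
Proof.
apply/(measurable_restrictT _ _).1 => //.
by apply: measurable_funS mls => //; exact: sub_oc.
Qed.

Let int_ls : leb.-integrable `[0, tau] (EFin \o ls).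
Proof.
apply: measurable_bounded_integrable => //.
by rewrite /= lebesgue_measure_itv/=; case: ifP; rewrite ?ltry.
Qed.

Let int_ls_oc c : 0 <= c -> leb.-integrable `]c, tau] (EFin \o ls).
Proof. by move=> c0; apply: integrableS int_ls => //; exact: sub_oc. Qed.

Lemma integral_restricted_intensity (U : set (measurableTypeR R)) :
  (\int[leb]_(y in U) (la y)%:E =
   \int[leb]_(y in U `&` `]0%R, tau]%classic) (ls y)%:E)%E.
Proof. by rewrite integral_mkcondr; under [RHS]eq_integral do rewrite restrict_EFin. Qed.

Definition mean_increment (c : R) : R := \int[leb]_(r in `[c, tau]) ls r.

Let mean_incrementE c : 0 <= c ->
  (\int[leb]_(y in `]c, tau]) (ls y)%:E = (mean_increment c)%:E)%E.
Proof.
move=> c0; rewrite /mean_increment -Rintegral_itv_obnd_cbnd; last exact: int_ls_oc.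
by rewrite /Rintegral fineK//; exact: integrable_fin_num (int_ls_oc c0).
Qed.

Let mean_increment_tau : mean_increment tau = 0.
Proof. by rewrite /mean_increment set_itv1 Rintegral_set1. Qed.

Let mean_increment_gt0 c : 0 <= c -> c < tau -> 0 < mean_increment c.
Proof.
move=> c0 ctau; rewrite -lte_fin -mean_incrementE//; apply: integral_gt0 => //.
- by rewrite /= lebesgue_measure_itv/= lte_fin ctau -EFinB lte_fin subr_gt0.
- by apply: measurable_funS mls => //; exact: sub_oc.
- by move=> x /(sub_oc c0); exact: ls0.
Qed.

Lemma restricted_intensity_fin : (\int[leb]_y (la y)%:E < +oo)%E.
Proof.
by rewrite integral_restricted_intensity setTI mean_incrementE// ltry.
Qed.

Let count c j w := Num.truncn (X j w tau - X j w c).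

Let countE c j w : 0 <= c -> c <= tau -> X j w tau - X j w c = (count c j w)%:R.
Proof.
move=> c0 ctau; apply: counting_path_increment => //.
by move=> t; exact: pp_counting.
Qed.

Let count_set c j k : 0 <= c -> c <= tau ->
  [set w | count c j w = k] = [set w | X j w tau - X j w c = k%:R].
Proof.
move=> c0 ctau; apply/seteqP; split => w /=; rewrite countE//; first by move=> ->.
by move=> /eqP; rewrite eqr_nat => /eqP.
Qed.

Let tauI : tau \in `[0, tau]. Proof. by rewrite in_itv/= lexx ltW. Qed.

Let mX j t : t \in `[0, tau] -> measurable_fun setT (fun w => X j w t : R).
Proof. exact: pp_measurable. Qed.

Let mcount c j k : 0 <= c -> c <= tau -> measurable [set w | count c j w = k].
Proof.
move=> c0 ctau; rewrite count_set//.
have mD : measurable_fun setT (fun w => X j w tau - X j w c).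
  by apply: measurable_funB; apply: mX => //; rewrite in_itv/= c0.
by have := mD measurableT [set k%:R] (measurable_set1 _); rewrite setTI.
Qed.

Let Pcount c j k : 0 <= c -> c < tau ->
  P [set w | count c j w = k] = (poisson_pmf (mean_increment c) k)%:E.
Proof. by move=> c0 ctau; rewrite count_set ?(ltW ctau)//; exact: pp_poisson_increments. Qed.

(** The events of an increment belong to the sigma-algebra of the process: an
    increment is k when, for some l, the path goes from l to k + l. *)
Let count_sigma c j k : 0 <= c -> c <= tau ->
  sigma_process `[0, tau] (fun t w => X j w t) [set w | count c j w = k].
Proof.
move=> c0 ctau; set S := sigma_process _ _.
have cI : c \in `[0, tau] by rewrite in_itv/= c0.
have SX t (l : nat) : t \in `[0, tau] -> S [set w | X j w t = l%:R].
  move=> tI; apply: sub_gen_smallest; exists t => //.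
  by exists [set l%:R] => //; rewrite setTI.
have -> : [set w | count c j w = k] =
    \bigcup_l ([set w | X j w tau = (k + l)%:R] `&` [set w | X j w c = l%:R]).
  rewrite count_set//; apply/seteqP; split => [w /= Xk|w [l _ [/= -> ->]]].
    have /natrP[l Xc] : X j w c \is a Num.nat by exact: pp_counting.
    by exists l => //=; rewrite natrD -Xk Xc subrK.
  by rewrite natrD addrK.
apply: sigma_algebra_bigcup => l.
apply: (@measurableI _ (g_sigma_algebraType
  (\bigcup_(t in `[0, tau]) g_sigma_algebra_preimage (fun w => X j w t)))).
- exact: SX.
- exact: SX.
Qed.

Let indep_count c i j k l : 0 <= c -> c <= tau -> i != j ->
  P ([set w | count c i w = k] `&` [set w | count c j w = l]) =
  (P [set w | count c i w = k] * P [set w | count c j w = l])%E.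
Proof.
move=> c0 ctau ij.
pose A h := if h == i then [set w | count c i w = k] else [set w | count c j w = l].
have := @indX [fset i; j]%fset A.
rewrite big_fsetU1 ?inE// big_seq_fset1 /A eqxx eq_sym (negbTE ij).
move=> <-; last first.
  move=> h; rewrite !inE => /orP[] /eqP ->; rewrite ?eqxx ?(eq_sym j) ?(negbTE ij).
    exact: count_sigma.
  exact: count_sigma.
congr (P _); apply/seteqP; split => w /=.
  move=> [wi wj] h /=; rewrite !inE => /orP[] /eqP ->; rewrite ?eqxx//.
  by rewrite eq_sym (negbTE ij).
move=> H; split.
  by have := H i; rewrite /= !inE eqxx/= => /(_ isT).
by have := H j; rewrite /= !inE eqxx orbT eq_sym (negbTE ij) => /(_ isT).
Qed.

Let N j w := jump_measure tau (X j w).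

Let natN j w : natural_measure (N j w).
Proof. by apply: natural_jump_measure => // t; exact: pp_counting. Qed.

Let N_itv j w (c : R) : N j w `]c, +oo[%classic = (count (clamp tau c) j w)%:R%:E.
Proof.
rewrite /N jump_measure_itv//; have := clamp_itv tau0 c.
by rewrite in_itv/= => /andP[? ?]; rewrite countE.
Qed.

Let N_setT j w : N j w setT = (count 0 j w)%:R%:E.
Proof. by rewrite /N jump_measure_setT// countE// ltW. Qed.

Let mcountr c j : 0 <= c -> c <= tau ->
  measurable_fun setT (fun w => (count c j w)%:R%:E : \bar R).
Proof.
move=> c0 ctau; apply/measurable_EFinP.
by apply: (measurable_count (fun k => k%:R)) => k; exact: mcount.
Qed.

Lemma measurable_jump_measure j (U : set (measurableTypeR R)) : measurable U ->
  measurable_fun setT (fun w => jump_measure tau (X j w) U).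
Proof.
move: U; apply: (random_measure_gen (natN j) (measurable_open_rays R) (@setI_closed_open_rays R)).
  apply: (eq_measurable_fun (fun w => (count 0 j w)%:R%:E)).
    by move=> w _; exact/esym/N_setT.
  by apply: mcountr => //; exact: ltW.
move=> _ [c ->]; apply: (eq_measurable_fun (fun w => (count (clamp tau c) j w)%:R%:E)).
  by move=> w _; exact/esym/N_itv.
by have := clamp_itv tau0 c; rewrite in_itv/= => /andP[? ?]; exact: mcountr.
Qed.

Let mean_count c j : 0 <= c -> c <= tau ->
  (\int[P]_w (count c j w)%:R%:E = (mean_increment c)%:E)%E.
Proof.
move=> c0; rewrite le_eqVlt => /predU1P[->|ctau].
  rewrite mean_increment_tau integral0_eq// => w _.
  by rewrite /count subrr truncn0.
apply: poisson_mean; first exact: mean_increment_gt0.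
  by move=> k; apply: mcount => //; exact: ltW.
by move=> k; exact: Pcount.
Qed.

Lemma mean_jump_measure j (U : set (measurableTypeR R)) : measurable U ->
  (\int[P]_w jump_measure tau (X j w) U = \int[leb]_(y in U) (la y)%:E)%E.
Proof.
move: U; apply: (mean_measure_gen (measurable_jump_measure j)
  restricted_intensity_ge0 measurable_restricted_intensity
  restricted_intensity_fin (measurable_open_rays R) (@setI_closed_open_rays R)).
  rewrite (eq_integral (fun w => (count 0 j w)%:R%:E)); last first.
    by move=> w _; exact: N_setT.
  by rewrite mean_count ?(ltW tau0)// integral_restricted_intensity setTI mean_incrementE.
move=> _ [c ->].
rewrite (eq_integral (fun w => (count (clamp tau c) j w)%:R%:E)); last first.
  by move=> w _; exact: N_itv.
have := clamp_itv tau0 c; rewrite in_itv/= => /andP[c0 ctau].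
by rewrite mean_count// integral_restricted_intensity setI_itv_clamp// mean_incrementE.
Qed.

(** At [c = tau] both the count and its mean vanish; there is then no Poisson law
    of positive rate to invoke. *)
Let lln_count (U : set (measurableTypeR R)) c : measurable U -> 0 <= c -> c <= tau ->
  (forall j w, N j w U = (count c j w)%:R%:E) ->
  mean_lln P leb la N \1_U.
Proof.
move=> mU c0 ctau NU.
have IN j w : \int[N j w]_y \1_U y = (count c j w)%:R.
  by rewrite /Rintegral integral_indic// setIT NU.
have meanU : (\int[leb]_y (\1_U y * la y))%R = mean_increment c.
  have /(congr1 fine) := mean_jump_measure 0 mU.
  rewrite (eq_integral (fun w => (count c 0 w)%:R%:E)); last first.
    by move=> w _; exact: NU.
  rewrite mean_count//= => ->; rewrite /Rintegral [in RHS]integral_mkcond.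
  congr fine; apply: eq_integral => y _; rewrite /patch indicE.
  by case: (y \in U); rewrite ?mul1r ?mul0r.
split => e e0; rewrite /mean_deviation.
move: ctau; rewrite le_eqVlt => /predU1P[ctau|ctau].
  apply: nearW => n; rewrite meanU ctau mean_increment_tau integral0_eq ?lee_fin ?ltW//.
  move=> w _; rewrite /empirical_mean big1 ?mulr0 ?subr0 ?normr0// => j _.
  by rewrite IN ctau /count subrr truncn0.
have := poisson_counts_lln (mean_increment_gt0 c0 ctau)
  (fun j k => mcount j k c0 (ltW ctau)) (fun j k => Pcount j k c0 ctau)
  (fun i j k l => @indep_count c i j k l c0 (ltW ctau)) e0.
apply: filterS => n; apply: le_trans; rewrite le_eqVlt; apply/orP; left; apply/eqP.
apply: eq_integral => w _; rewrite meanU /empirical_mean.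
by under eq_bigr do rewrite IN.
Qed.

Theorem poisson_process_lln (f : measurableTypeR R -> R) :
  measurable_fun setT f -> (forall t, 0 <= f t) -> mean_integrable leb la f ->
  mean_lln P leb la (fun j w => jump_measure tau (X j w)) f.
Proof.
move=> mf f0 intf.
apply: (mean_lln_ge0 natN measurable_jump_measure restricted_intensity_ge0
  measurable_restricted_intensity restricted_intensity_fin mean_jump_measure
  (measurable_open_rays R) (@setI_closed_open_rays R)) => //.
- by apply: (@lln_count _ 0) => //; exact: ltW.
- move=> _ [c ->]; have := clamp_itv tau0 c; rewrite in_itv/= => /andP[c0 ctau].
  by apply: (@lln_count _ (clamp tau c)).
Qed.

End poisson_process_lln.

(** * Events of vanishing probability *)

Section convergence_of_events.
Context d (T : measurableType d) (R : realType) (P : probability T R).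
Set Implicit Arguments.
Unset Strict Implicit.

Lemma cvg_probability0 (A : nat -> set T) : (forall n, measurable (A n)) ->
  (forall e, 0 < e -> \forall n \near \oo, (P (A n) <= e%:E)%E) ->
  P (A n) @[n --> \oo] --> 0%E.
Proof.
move=> mA Ae; apply: cvg_EFin; first by apply: nearW => n; exact: fin_num_measure.
apply/cvgrPdist_le => e /Ae; apply: filterS => n /=.
rewrite sub0r normrN ger0_norm ?fine_ge0// => Pe.
by rewrite -lee_fin fineK ?fin_num_measure.
Qed.

Lemma cvg_probability_sub (A B : nat -> set T) : (forall n, measurable (A n)) ->
  (forall n, measurable (B n)) -> P (B n) @[n --> \oo] --> 0%E ->
  (\forall n \near \oo, A n `<=` B n) -> P (A n) @[n --> \oo] --> 0%E.
Proof.
move=> mA mB B0 AB; apply: cvg_probability0 => // e e0.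
have /fine_cvgP[_ /cvgrPdist_le/(_ _ e0)] := B0.
apply: filterS2 AB => n AB /=; rewrite sub0r normrN ger0_norm ?fine_ge0// => Be.
rewrite (@le_trans _ _ (P (B n)))//; first by rewrite le_measure ?inE.
by rewrite -(fineK (fin_num_measure P _ (mB n))) lee_fin.
Qed.

Context d' (Y : measurableType d') (mu : {measure set Y -> \bar R}) (la : Y -> R)
  (N : nat -> T -> {measure set Y -> \bar R}).
Hypothesis mN : forall j U, measurable U ->
  measurable_fun setT (fun w => N j w U).

(** The Markov inequality for the sum of the deviations of finitely many
    functions. *)
Lemma mean_lln_probability (I : Type) (r : seq I) (F : I -> Y -> R) (b : R) :
  (forall i, measurable_fun setT (F i)) ->
  (forall i, mean_lln P mu la N (F i)) -> 0 < b ->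
  let dev n w := \sum_(i <- r)
    `|empirical_mean N n (F i) w - \int[mu]_y (F i y * la y)| in
  (forall n, measurable [set w | b <= dev n w]) /\
  P [set w | b <= dev n w] @[n --> \oo] --> 0%E.
Proof.
move=> mF llnF b0 dev.
have mdev n : measurable_fun setT (dev n).
  apply: measurable_sum => i; apply: measurableT_comp => //.
  by apply: measurable_funB => //; exact: measurable_empirical_mean.
have dev0 n w : 0 <= dev n w by exact: sumr_ge0.
have mA n : measurable [set w | b <= dev n w] by exact: measurable_ler_set.
split => //; apply: cvg_probability0 => // e e0.
have Edev e' : 0 < e' -> \forall n \near \oo,
    (\sum_(i <- r) mean_deviation P mu la N n (F i) <= e'%:E)%E.
  elim: {dev mdev dev0 mA} r e' => [|i r ih] e' e'0.
    by apply: nearW => n; rewrite big_nil lee_fin ltW.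
  have e'20 : 0 < e' / 2 by rewrite divr_gt0.
  have [llni] := llnF i.
  apply: filterS2 (ih _ e'20) (llni _ e'20) => n h1 h2; rewrite big_cons.
  have -> : e'%:E = ((e' / 2)%:E + (e' / 2)%:E)%E by rewrite -EFinD; congr EFin; field.
  exact: leeD.
apply: filterS (Edev _ (mulr_gt0 b0 e0)) => n; rewrite /mean_deviation.
rewrite -ge0_integral_sum//; last first.
  move=> i; apply/measurable_EFinP; apply: measurableT_comp => //.
  by apply: measurable_funB => //; exact: measurable_empirical_mean.
rewrite (eq_integral (fun w => (dev n w)%:E)); last by move=> w _; rewrite sumEFin.
have mEdev : measurable_fun setT (EFin \o dev n) by exact/measurable_EFinP.
have := le_integral_abse P measurableT mEdev b0.
rewrite setTI.
rewrite (eq_integral (fun w => (dev n w)%:E)); last first.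
  by move=> w _; rewrite /= ger0_norm.
have -> : [set w | (b%:E <= `|(EFin \o dev n) w|)%E] = [set w | b <= dev n w].
  by apply/seteqP; split => w /=; rewrite lee_fin ger0_norm.
move=> h1 h2; have := le_trans h1 h2.
by rewrite EFinM lee_pmul2l.
Qed.

End convergence_of_events.

(** * The likelihood of the change-point model *)

Section change_point_model.
Context (R : realType) (tau : R).
Set Implicit Arguments.
Unset Strict Implicit.
Variables (g1 g2 ls : R -> R).
Local Notation leb := (@lebesgue_measure R).
Local Notation la := (restricted_intensity tau ls).
Local Notation mT := (measurableTypeR R).

Definition before (h : R -> R) (s : R) : mT -> R :=
  fun t => h t * (t < s)%R%:R.

Definition log_ratio : mT -> R := (fun t => ln (g2 t / g1 t)) \_ `]0, tau].

Definition gap : mT -> R := (fun t => g2 t - g1 t) \_ `]0, tau].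

(** The bound exceeds (g2 - g1) / ls, the value at which the product of the ratio
    and the intensity balances the gap: truncation keeps the sign of the
    difference and makes the product with the intensity bounded. *)
Definition truncated_ratio : mT -> R :=
  (fun t => Num.min (ln (g2 t / g1 t)) (1 + (g2 t - g1 t) / ls t)) \_ `]0, tau].

Definition integrated_gap (s : R) : R := \int[leb]_t before gap s t.

Definition integrated_ratio (s : R) : R :=
  \int[leb]_t (before truncated_ratio s t * la t).

Hypothesis tau0 : 0 < tau.
Hypotheses (mg1 : measurable_fun `[0, tau] g1) (mg2 : measurable_fun `[0, tau] g2)
  (mls : measurable_fun `[0, tau] ls).
Hypotheses (bg1 : [bounded g1 t : R^o | t in `[0, tau]])
  (bg2 : [bounded g2 t : R^o | t in `[0, tau]])
  (bls : [bounded ls t : R^o | t in `[0, tau]]).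
Hypothesis gpos : forall t, t \in `[0, tau] -> 0 < g1 t /\ g1 t < g2 t.
Hypothesis ls0 : forall t, t \in `[0, tau] -> 0 < ls t.

Lemma exists_bound (f : R -> R) (A : set R) :
  [bounded f t : R^o | t in A] -> exists C, 0 <= C /\ forall t, A t -> `|f t| <= C.
Proof.
move=> [M [_ Mf]]; exists (Num.max 0 (M + 1)); split; first by rewrite le_max lexx.
move=> t At; rewrite le_max; apply/orP; right.
by apply: Mf => //; rewrite ltrDl.
Qed.

Lemma sub_itvoc_itvcc : `]0, tau] `<=` `[0, tau].
Proof. by move=> t /=; rewrite !in_itv/= => /andP[/ltW -> ->]. Qed.

Lemma measurable_patch_oc (f : R -> R) :
  measurable_fun `[0, tau] f -> measurable_fun setT (f \_ `]0, tau] : mT -> R).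
Proof.
move=> mf; apply/(measurable_restrictT _ _).1 => //.
by apply: measurable_funS mf => //; exact: sub_itvoc_itvcc.
Qed.

Lemma measurable_before (h : mT -> R) s :
  measurable_fun setT h -> measurable_fun setT (before h s).
Proof.
move=> mh; apply: measurable_funM => //.
rewrite (_ : (fun t => _) = \1_(`]-oo, s[ : set mT)); first exact: measurable_indic.
by apply/funext => t; rewrite indicE mem_setE in_itv.
Qed.

Lemma integrable_bounded_oc (f : R -> R) C :
  measurable_fun `[0, tau] f -> (forall t, t \in `[0, tau] -> `|f t| <= C) ->
  leb.-integrable setT (EFin \o (f \_ `]0, tau])).
Proof.
move=> mf fC; rewrite -restrict_EFin; apply/(integrable_mkcond _ _).1 => //.
apply: measurable_bounded_integrable => //.
- by rewrite /= lebesgue_measure_itv/=; case: ifP; rewrite ?ltry.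
- by apply: measurable_funS mf => //; exact: sub_itvoc_itvcc.
- exists C; split; first exact: num_real.
  move=> x Cx t /= /sub_itvoc_itvcc tI; apply: le_trans (ltW Cx).
  exact: fC.
Qed.

Lemma integrable_le (f g : mT -> R) : measurable_fun setT f ->
  leb.-integrable setT (EFin \o g) -> (forall t, `|f t| <= g t) ->
  leb.-integrable setT (EFin \o f).
Proof.
move=> mf ig fg; apply: le_integrable ig => //; first exact/measurable_EFinP.
by move=> t _; rewrite /= lee_fin (le_trans (fg t))// ler_norm.
Qed.

Lemma before_le (h : mT -> R) s : (forall t, 0 <= h t) -> forall t, 0 <= before h s t <= h t.
Proof.
move=> h0 t; rewrite /before; case: (t < s) => /=.
  by rewrite mulr1 lexx h0.
by rewrite mulr0 lexx h0.
Qed.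

Lemma measurable_ln_comp (f : R -> R) : measurable_fun `[0, tau] f ->
  measurable_fun `[0, tau] (fun t => ln (f t)).
Proof. by move=> mf; apply: measurableT_comp => //; exact: measurable_ln. Qed.

Lemma measurable_inv_comp (f : R -> R) : measurable_fun `[0, tau] f ->
  (forall t, t \in `[0, tau] -> 0 < f t) ->
  measurable_fun `[0, tau] (fun t => (f t)^-1).
Proof.
move=> mf f0; apply: (eq_measurable_fun (fun t => expR (- ln (f t)))).
  by move=> t; rewrite mem_setE => /f0 ft0; rewrite expRN lnK.
apply: measurableT_comp; first exact: measurable_expR.
by apply: measurable_funN; exact: measurable_ln_comp.
Qed.

Let mratio : measurable_fun `[0, tau] (fun t => ln (g2 t / g1 t)).
Proof.
apply: measurable_ln_comp; apply: measurable_funM => //.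
by apply: measurable_inv_comp => // t /gpos[].
Qed.

Lemma measurable_log_ratio : measurable_fun setT log_ratio.
Proof. exact: measurable_patch_oc. Qed.

Lemma measurable_gap : measurable_fun setT gap.
Proof. by apply: measurable_patch_oc; exact: measurable_funB. Qed.

Lemma measurable_truncated_ratio : measurable_fun setT truncated_ratio.
Proof.
apply: measurable_patch_oc; apply: measurable_minr => //.
apply: measurable_funD => //; apply: measurable_funM.
  exact: measurable_funB.
exact: measurable_inv_comp.
Qed.

Let inD t : (t \in `]0, tau]%classic) -> t \in `[0, tau].
Proof. by rewrite mem_setE => /sub_itvoc_itvcc. Qed.

Lemma ln_ratio_gt0 t : t \in `[0, tau] -> 0 < ln (g2 t / g1 t).
Proof. by move=> /gpos[g10 g12]; rewrite ln_gt0// ltr_pdivlMr// mul1r. Qed.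

Lemma log_ratio_ge0 t : 0 <= log_ratio t.
Proof. by rewrite /log_ratio /patch; case: ifPn => // /inD/ln_ratio_gt0/ltW. Qed.

Lemma gap_ge0 t : 0 <= gap t.
Proof. by rewrite /gap /patch; case: ifPn => // /inD/gpos[_ /ltW]; rewrite subr_ge0. Qed.

Lemma truncated_ratio_ge0 t : 0 <= truncated_ratio t.
Proof.
rewrite /truncated_ratio /patch; case: ifPn => // /inD tI.
have [_ g12] := gpos tI.
by rewrite le_min (ltW (ln_ratio_gt0 tI)) addr_ge0// divr_ge0 ?subr_ge0 ?ltW// ls0.
Qed.

Lemma truncated_ratio_le t : truncated_ratio t <= log_ratio t.
Proof.
by rewrite /truncated_ratio /log_ratio /patch; case: ifPn => // _; rewrite ge_min lexx.
Qed.

Lemma truncated_ratio_mean_le t : truncated_ratio t * la t <= la t + gap t.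
Proof.
rewrite /truncated_ratio /restricted_intensity /gap /patch; case: ifPn => [/inD tI|_].
  have lt0 := ls0 tI.
  apply: (@le_trans _ _ ((1 + (g2 t - g1 t) / ls t) * ls t)).
    by rewrite ler_wpM2r ?ge_min ?lexx ?orbT// ltW.
  by rewrite mulrDl mul1r divfK// gt_eqF.
by rewrite mulr0 addr0.
Qed.

Let int_gap : leb.-integrable setT (EFin \o gap).
Proof.
have [C1 [_ C1g]] := exists_bound bg1; have [C2 [_ C2g]] := exists_bound bg2.
apply: (@integrable_bounded_oc _ (C2 + C1)); first exact: measurable_funB.
by move=> t tI; rewrite (le_trans (ler_normB _ _))// lerD ?C1g ?C2g.
Qed.

Let int_la : leb.-integrable setT (EFin \o la).
Proof. by have [C [_ Cl]] := exists_bound bls; exact: (@integrable_bounded_oc _ C). Qed.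

Lemma exists_mean_bound : exists C, 0 <= C /\
  forall t, la t + gap t <= C /\ gap t <= C.
Proof.
have [C1 [C10 C1g]] := exists_bound bg1; have [C2 [C20 C2g]] := exists_bound bg2.
have [C [C0 Cl]] := exists_bound bls.
exists (C + (C2 + C1)); split; first by rewrite !addr_ge0.
move=> t; rewrite /restricted_intensity /gap /patch; case: ifPn => [/inD tI|_]; last first.
  by rewrite addr0 !addr_ge0.
have gC : g2 t - g1 t <= C2 + C1.
  rewrite (le_trans (ler_norm _))// (le_trans (ler_normB _ _))// lerD//.
    exact: C2g.
  exact: C1g.
have lC : ls t <= C by rewrite (le_trans (ler_norm _))// Cl.
by split; [exact: lerD|rewrite (le_trans gC)// lerDr].
Qed.

Lemma integrable_before_gap s : leb.-integrable setT (EFin \o before gap s).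
Proof.
apply: (@integrable_le _ gap) => //.
  by apply: measurable_before; exact: measurable_gap.
by move=> t; have /andP[h0 h1] := before_le s gap_ge0 t; rewrite ger0_norm.
Qed.

Lemma mean_integrable_before_ratio s : mean_integrable leb la (before truncated_ratio s).
Proof.
have la_ge0 := restricted_intensity_ge0 ls0.
apply: (@integrable_le _ (fun t => la t + gap t)).
- apply: measurable_funM; last exact: measurable_restricted_intensity.
  by apply: measurable_before; exact: measurable_truncated_ratio.
- exact: (integrableD measurableT int_la int_gap).
- move=> t; have /andP[h0 h1] := before_le s truncated_ratio_ge0 t.
  have l0 := la_ge0 t; rewrite (ger0_norm (mulr_ge0 h0 l0)).
  apply: le_trans (truncated_ratio_mean_le t).
  exact: ler_wpM2r.
Qed.

(** On the window, ln (lam theta t) is ln (g2 t) minus the log-ratio before theta,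
    and lam theta t is g2 t minus the gap before theta. *)
Lemma likelihoodE (n : nat) (x : nat -> cumulative R R) :
  (forall j, counting_path tau (x j)) -> exists2 C : R, 0 < C &
  forall theta, likelihood tau (switch_intensity g1 g2) n x theta =
    C * expR (n%:R * integrated_gap theta -
      \sum_(j < n) \int[jump_measure tau (x j)]_t before log_ratio theta t).
Proof.
move=> xn.
pose lng2 : mT -> R := (fun t => ln (g2 t)) \_ `]0, tau].
pose g21 : mT -> R := (fun t => g2 t - 1) \_ `]0, tau].
have mlng2 : measurable_fun setT lng2.
  by apply: measurable_patch_oc; exact: measurable_ln_comp.
exists (expR (\sum_(j < n) \int[jump_measure tau (x j)]_t lng2 t -
    n%:R * \int[leb]_t g21 t)); first exact: expR_gt0.
move=> theta; rewrite /likelihood -expRD; congr expR.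
have -> : \int[leb]_(t in `[0, tau]) (switch_intensity g1 g2 theta t - 1) =
    \int[leb]_t g21 t - integrated_gap theta.
  have [C2 [C20 C2g]] := exists_bound bg2.
  have int_g21 : leb.-integrable setT (EFin \o g21).
    apply: (@integrable_bounded_oc _ (C2 + 1)); first exact: measurable_funB.
    by move=> t tI; rewrite (le_trans (ler_normB _ _))// normr1 lerD2r C2g.
  have E : (fun t => switch_intensity g1 g2 theta t - 1) \_ `]0, tau] =
      (fun t => g21 t - before gap theta t).
    apply/funext => t; rewrite /g21 /before /gap /patch.
    case: ifPn => _; last by rewrite mul0r subrr.
    by rewrite /switch_intensity; case: ltP => _ /=; ring.
  rewrite -Rintegral_itv_obnd_cbnd.
    rewrite Rintegral_mkcond E RintegralB//; exact: integrable_before_gap.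
  apply/(integrable_mkcond _ _).2 => //; rewrite restrict_EFin E.
  exact: (integrableB measurableT int_g21 (integrable_before_gap theta)).
rewrite (eq_bigr (fun j : 'I_n => \int[jump_measure tau (x j)]_t lng2 t -
    \int[jump_measure tau (x j)]_t before log_ratio theta t)).
  by rewrite sumrB; ring.
move=> j _; have nj := natural_jump_measure tau0 (xn j).
rewrite jump_integral -RintegralB//; last 2 first.
- exact: natural_measure_integrable.
- apply: natural_measure_integrable => //.
  by apply: measurable_before; exact: measurable_log_ratio.
apply: eq_Rintegral => t _; rewrite /lng2 /before /log_ratio /patch.
case: ifPn => [/inD tI|_]; last by rewrite mul0r subrr.
have [g10 g12] := gpos tI; have g20 := lt_trans g10 g12.
rewrite /switch_intensity ln_div ?posrE//.
by case: ltP => _ /=; rewrite ?mulr1 ?mulr0 ?addr0 ?add0r ?subr0// subKr.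
Qed.

End change_point_model.

(** * Separation of the change point *)

Section separation.
Context (R : realType) (tau : R).
Set Implicit Arguments.
Unset Strict Implicit.
Variables (g1 g2 ls : R -> R) (theta0 : R).
Local Notation leb := (@lebesgue_measure R).
Local Notation la := (restricted_intensity tau ls).
Local Notation mT := (measurableTypeR R).
Local Notation log_ratio := (log_ratio tau g1 g2).
Local Notation gap := (gap tau g1 g2).
Local Notation truncated_ratio := (truncated_ratio tau g1 g2 ls).
Local Notation integrated_gap := (integrated_gap tau g1 g2).
Local Notation integrated_ratio := (integrated_ratio tau g1 g2 ls).

Hypothesis tau0 : 0 < tau.
Hypotheses (mg1 : measurable_fun `[0, tau] g1) (mg2 : measurable_fun `[0, tau] g2)
  (mls : measurable_fun `[0, tau] ls).
Hypotheses (bg1 : [bounded g1 t : R^o | t in `[0, tau]])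
  (bg2 : [bounded g2 t : R^o | t in `[0, tau]])
  (bls : [bounded ls t : R^o | t in `[0, tau]]).
Hypothesis gpos : forall t, t \in `[0, tau] -> 0 < g1 t /\ g1 t < g2 t.
Hypothesis ls0 : forall t, t \in `[0, tau] -> 0 < ls t.
Hypothesis ls_before : forall t, t \in `[0, tau] -> t < theta0 ->
  ls t * ln (g2 t / g1 t) < g2 t - g1 t.
Hypothesis ls_after : forall t, t \in `[0, tau] -> theta0 <= t ->
  g2 t - g1 t < ls t * ln (g2 t / g1 t).

Let la_ge0 := restricted_intensity_ge0 ls0.
Let mla := measurable_restricted_intensity mls.
Let mtr := measurable_truncated_ratio mg1 mg2 mls gpos ls0.
Let mlr := measurable_log_ratio mg1 mg2 gpos.
Let mgap := measurable_gap mg1 mg2.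
Let int_tr := mean_integrable_before_ratio mg1 mg2 mls bg1 bg2 bls gpos ls0.
Let int_gap := integrable_before_gap mg1 mg2 bg1 bg2 gpos.

Let inD t : (t \in `]0, tau]%classic) -> t \in `[0, tau].
Proof. by rewrite mem_setE => /sub_itvoc_itvcc. Qed.

Lemma truncated_ratio_before t : t < theta0 -> truncated_ratio t = log_ratio t.
Proof.
rewrite /truncated_ratio /log_ratio /patch; case: ifPn => // /inD tI t0.
apply: min_l; have lt0 := ls0 tI.
rewrite (@le_trans _ _ ((g2 t - g1 t) / ls t))//; last by rewrite lerDr.
by rewrite ler_pdivlMr// mulrC ltW// ls_before.
Qed.

(** Negative before [theta0] and positive afterwards on the window.  Its integral
    before theta is, up to sign and an additive constant, the limit of the
    truncated log-likelihood per observation. *)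
Definition excess (t : mT) : R := truncated_ratio t * la t - gap t.

Lemma excess_notin t : ~ `]0, tau]%classic t -> excess t = 0.
Proof.
move=> tD; rewrite /excess /restricted_intensity /gap /patch memNset//.
by rewrite mulr0 subr0.
Qed.

Lemma excess_lt0 t : `]0, tau]%classic t -> t < theta0 -> excess t < 0.
Proof.
move=> tD t0; rewrite /excess truncated_ratio_before// /log_ratio /restricted_intensity /gap.
rewrite /patch mem_set// subr_lt0 mulrC ls_before//.
by apply: inD; rewrite mem_set.
Qed.

Lemma excess_gt0 t : `]0, tau]%classic t -> theta0 <= t -> 0 < excess t.
Proof.
move=> tD t0; rewrite /excess /truncated_ratio /restricted_intensity /gap.
have tI : t \in `[0, tau] by apply: inD; rewrite mem_set.
rewrite /patch mem_set// subr_gt0; have lt0 := ls0 tI.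
rewrite -ltr_pdivrMr// lt_min ltrDr ltr01 andbT.
by rewrite ltr_pdivrMr// mulrC ls_after.
Qed.

Lemma excess_le0 t : t < theta0 -> excess t <= 0.
Proof.
move=> t0; have [tD|tD] := pselect (`]0, tau]%classic t); last by rewrite excess_notin.
by rewrite ltW// excess_lt0.
Qed.

Lemma excess_ge0 t : theta0 <= t -> 0 <= excess t.
Proof.
move=> t0; have [tD|tD] := pselect (`]0, tau]%classic t); last by rewrite excess_notin.
by rewrite ltW// excess_gt0.
Qed.

Lemma measurable_excess : measurable_fun setT excess.
Proof. by apply: measurable_funB => //; exact: measurable_funM. Qed.

Lemma before_excess s t : before excess s t = before truncated_ratio s t * la t - before gap s t.
Proof. by rewrite /before /excess mulrBl mulrAC. Qed.

Lemma integrable_before_excess s : leb.-integrable setT (EFin \o before excess s).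
Proof.
rewrite (_ : before excess s =
    fun t => before truncated_ratio s t * la t - before gap s t); last first.
  by apply/funext => t; exact: before_excess.
exact: (integrableB measurableT (int_tr s) (int_gap s)).
Qed.

Lemma integral_before_excess s :
  \int[leb]_t before excess s t = integrated_ratio s - integrated_gap s.
Proof.
rewrite /integrated_ratio /integrated_gap -RintegralB//; last exact: int_tr.
by apply: eq_Rintegral => t _; exact: before_excess.
Qed.

Lemma integrable_excess : leb.-integrable setT (EFin \o excess).
Proof.
apply: eq_integrable (integrable_before_excess (tau + 1)) => // t _ /=.
rewrite /before; have [tt|tt] := ltP t (tau + 1); first by rewrite mulr1.
rewrite mulr0 excess_notin// => /=; rewrite in_itv/= => /andP[_ ttau].
by move: tt; rewrite leNgt (le_lt_trans ttau)// ltrDl.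
Qed.

Let mass (A : set mT) := \int[leb]_(t in A) `|excess t|.

Let mass_gt0 (a b : R) : a < b -> `]a, b[ `<=` `]0, tau]%classic -> 0 < mass `]a, b[%classic.
Proof.
move=> ab abD; have mI : measurable (`]a, b[%classic : set mT) by [].
have iE : leb.-integrable `]a, b[ (EFin \o (fun t => `|excess t|)).
  apply: (integrableS measurableT mI) => //.
  exact: (integrable_norm integrable_excess).
rewrite -lte_fin /mass /Rintegral fineK; last exact: integrable_fin_num iE.
apply: integral_gt0 => //.
- by rewrite /= lebesgue_measure_itv/= lte_fin ab -EFinB lte_fin subr_gt0.
- by apply: measurable_funTS; apply: measurableT_comp => //; exact: measurable_excess.
move=> t /abD tD; rewrite normr_gt0.
by have [t0|t0] := ltP t theta0; [rewrite lt_eqF// excess_lt0|rewrite gt_eqF// excess_gt0].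
Qed.

Let mass_le (A : set mT) s s' : measurable A ->
  (forall t, A t -> `|excess t| <= before excess s t - before excess s' t) ->
  (forall t, 0 <= before excess s t - before excess s' t) ->
  mass A <= (integrated_ratio s - integrated_gap s) -
            (integrated_ratio s' - integrated_gap s').
Proof.
move=> mA hA h0; rewrite -!integral_before_excess.
rewrite -RintegralB//; try exact: integrable_before_excess.
rewrite /mass Rintegral_mkcond; apply: le_Rintegral => //.
- rewrite -restrict_EFin; apply/(integrable_mkcond _ _).1 => //.
  apply: (integrableS measurableT mA) => //.
  exact: (integrable_norm integrable_excess).
- exact: (integrableB measurableT (integrable_before_excess s)
    (integrable_before_excess s')).
- move=> t _; rewrite /patch; case: ifPn => [|_]; last exact: h0.
  by rewrite inE; exact: hA.
Qed.

(** Between [theta0] and a theta at distance at least eps, the excess has constant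
    sign, and its absolute value has positive integral over the half of the
    eps-neighbourhood of [theta0] on that side. *)
Lemma excess_separation eps : 0 < theta0 -> theta0 < tau -> 0 < eps ->
  exists2 c, 0 < c & forall theta, eps <= `|theta - theta0| ->
    c <= (integrated_ratio theta - integrated_gap theta) -
         (integrated_ratio theta0 - integrated_gap theta0).
Proof.
move=> th0 thtau eps0.
(* The half-neighbourhoods are cut at 0 and tau: outside of the window the excess
   vanishes and would not be of strict sign. *)
pose c1 := mass `](Num.max 0 (theta0 - eps)), theta0[%classic.
pose c2 := mass `]theta0, (Num.min tau (theta0 + eps))[%classic.
exists (Num.min c1 c2).
  rewrite lt_min; apply/andP; split; apply: mass_gt0.
  - by rewrite gt_max th0 ltrBlDr ltrDl.
  - move=> t /=; rewrite !in_itv/= gt_max => /andP[/andP[-> _] tt]/=.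
    by rewrite ltW// (lt_trans tt).
  - by rewrite lt_min thtau ltrDl.
  - move=> t /=; rewrite !in_itv/= lt_min => /andP[tt /andP[/ltW -> _]].
    by rewrite (lt_trans th0).
move=> theta; have [tt|tt] := leP theta0 theta.
  rewrite ger0_norm ?subr_ge0// lerBrDl => epst.
  rewrite ge_min; apply/orP; right; apply: mass_le => //.
  - move=> t /=; rewrite in_itv/= lt_min => /andP[t0 /andP[_ te]].
    rewrite /before (lt_le_trans te epst) [t < theta0]ltNge (ltW t0)/=.
    by rewrite mulr1 mulr0 subr0 ger0_norm// excess_ge0// ltW.
  - move=> t; rewrite /before; have [t0|t0] := ltP t theta0.
      by rewrite (lt_le_trans t0 tt) subrr.
    by rewrite mulr0 subr0 mulr_ge0// excess_ge0.
rewrite ltr0_norm ?subr_lt0// opprB lerBrDl => epst.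
rewrite ge_min; apply/orP; left; apply: mass_le => //.
- move=> t /=; rewrite in_itv/= gt_max => /andP[/andP[_ te] t0].
  have tn : (t < theta) = false.
    by apply/negbTE; rewrite -leNgt ltW// (le_lt_trans _ te)// lerBrDr.
  by rewrite /before t0 tn mulr1 mulr0 sub0r ler0_norm// excess_le0.
- move=> t; rewrite /before; have [t0|t0] := ltP t theta0; last first.
    by rewrite ltNge (le_trans (ltW tt) t0) subrr.
  case: (t < theta) => /=; first by rewrite subrr.
  by rewrite mulr1 mulr0 sub0r oppr_ge0 excess_le0.
Qed.

Lemma integral_before_lipschitz (h : mT -> R) C : 0 <= C -> (forall t, h t <= C) ->
  (forall s, leb.-integrable setT (EFin \o before h s)) ->
  forall s s', s <= s' ->
  \int[leb]_t before h s' t - \int[leb]_t before h s t <= C * (s' - s).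
Proof.
move=> C0 hC ih s s' ss'; rewrite -RintegralB//.
have iI : leb.-integrable setT (EFin \o \1_[set` Interval (BSide true s) (BSide true s')]).
  exact: integrable_indic_itv.
apply: (@le_trans _ _ (\int[leb]_t (C * \1_(`[s, s'[ : set R) t))).
  apply: le_Rintegral => //.
  - exact: (integrableB measurableT (ih s') (ih s)).
  - exact: (integrableZl measurableT C iI).
  - move=> t _; rewrite indicE mem_setE in_itv/= /before.
    have [ts|ts] /= := ltP t s.
      by rewrite (lt_le_trans ts ss') !mulr1 mulr0 subrr.
    case: (t < s') => /=; first by rewrite !mulr1 mulr0 subr0.
    by rewrite !mulr0 subrr.
rewrite RintegralZl// ler_wpM2l// /Rintegral integral_indic// setIT.
rewrite /= lebesgue_measure_itv/=; case: ifPn => _ /=; first exact: lexx.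
by rewrite subr_ge0.
Qed.

Lemma integrated_lipschitz : exists2 C, 0 <= C & forall s s', s <= s' ->
  integrated_ratio s' - integrated_ratio s <= C * (s' - s) /\
  integrated_gap s' - integrated_gap s <= C * (s' - s).
Proof.
have [C [C0 HC]] := exists_mean_bound bg1 bg2 bls; exists C => // s s' ss'.
have ratioE u : integrated_ratio u =
    \int[leb]_t before (fun t => truncated_ratio t * la t) u t.
  by apply: eq_Rintegral => t _; rewrite /before mulrAC.
split; last by apply: integral_before_lipschitz => // t; exact: (HC t).2.
rewrite !ratioE; apply: integral_before_lipschitz => // [t|u].
  by apply: le_trans (HC t).1; exact: truncated_ratio_mean_le.
rewrite (_ : before _ u = fun t => before truncated_ratio u t * la t).
  exact: int_tr.
by apply/funext => t; rewrite /before mulrAC.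
Qed.

(** The log-ratio and its truncation agree before [theta0], and the truncation is
    no larger elsewhere: the truncated sums overestimate the likelihood ratio. *)
Lemma jump_log_ratio_le (x : cumulative R R) theta : counting_path tau x ->
  \int[jump_measure tau x]_t before log_ratio theta0 t -
  \int[jump_measure tau x]_t before log_ratio theta t <=
  \int[jump_measure tau x]_t before truncated_ratio theta0 t -
  \int[jump_measure tau x]_t before truncated_ratio theta t.
Proof.
move=> xn; have nx := natural_jump_measure tau0 xn.
have iJ h : measurable_fun setT h -> (jump_measure tau x).-integrable setT (EFin \o h).
  exact: natural_measure_integrable.
have -> : \int[jump_measure tau x]_t before log_ratio theta0 t =
    \int[jump_measure tau x]_t before truncated_ratio theta0 t.
  apply: eq_Rintegral => t _; rewrite /before.
  by have [t0|t0] := ltP t theta0; [rewrite truncated_ratio_before|rewrite !mulr0].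
rewrite lerD2l lerN2; apply: le_Rintegral => //.
- by apply: iJ; exact: measurable_before.
- by apply: iJ; exact: measurable_before.
- by move=> t _; rewrite /before ler_wpM2r// truncated_ratio_le.
Qed.

End separation.

(** * Exponential domination of the likelihood *)

Section likelihood_separation.
Context (R : realType) (tau : R) d (T : measurableType d) (P : probability T R).
Set Implicit Arguments.
Unset Strict Implicit.
Variables (g1 g2 ls : R -> R) (theta0 : R) (X : nat -> T -> cumulative R R).
Local Notation leb := (@lebesgue_measure R).
Local Notation la := (restricted_intensity tau ls).
Local Notation mT := (measurableTypeR R).
Local Notation log_ratio := (log_ratio tau g1 g2).
Local Notation gap := (gap tau g1 g2).
Local Notation truncated_ratio := (truncated_ratio tau g1 g2 ls).
Local Notation integrated_gap := (integrated_gap tau g1 g2).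
Local Notation integrated_ratio := (integrated_ratio tau g1 g2 ls).

Hypothesis tau0 : 0 < tau.
Hypotheses (th0 : 0 < theta0) (thtau : theta0 < tau).
Hypotheses (mg1 : measurable_fun `[0, tau] g1) (mg2 : measurable_fun `[0, tau] g2)
  (mls : measurable_fun `[0, tau] ls).
Hypotheses (bg1 : [bounded g1 t : R^o | t in `[0, tau]])
  (bg2 : [bounded g2 t : R^o | t in `[0, tau]])
  (bls : [bounded ls t : R^o | t in `[0, tau]]).
Hypothesis gpos : forall t, t \in `[0, tau] -> 0 < g1 t /\ g1 t < g2 t.
Hypothesis ls0 : forall t, t \in `[0, tau] -> 0 < ls t.
Hypothesis ls_before : forall t, t \in `[0, tau] -> t < theta0 ->
  ls t * ln (g2 t / g1 t) < g2 t - g1 t.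
Hypothesis ls_after : forall t, t \in `[0, tau] -> theta0 <= t ->
  g2 t - g1 t < ls t * ln (g2 t / g1 t).
Hypothesis ppX : forall j, poisson_process P tau ls (X j).
Hypothesis indX : independent_processes P tau X.

Let L n w := likelihood tau (switch_intensity g1 g2) n (fun j => X j w).
Let N j w := jump_measure tau (X j w).

Let pathX w j : counting_path tau (X j w).
Proof. by move=> t; exact: pp_counting. Qed.

Let natN j w : natural_measure (N j w).
Proof. exact: natural_jump_measure. Qed.

Definition jump_sum n w (theta : R) : R :=
  \sum_(j < n) \int[N j w]_t before log_ratio theta t.

Lemma likelihood_jump_sum n w : exists2 C : R, 0 < C &
  forall theta, L n w theta =
    C * expR (n%:R * integrated_gap theta - jump_sum n w theta).
Proof. exact: likelihoodE. Qed.

Lemma likelihood_gt0 n w theta : 0 < L n w theta.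
Proof. by have [C C0 ->] := likelihood_jump_sum n w; rewrite mulr_gt0// expR_gt0. Qed.

Lemma jump_sum_ge0 n w theta : 0 <= jump_sum n w theta.
Proof.
apply: sumr_ge0 => j _; apply: Rintegral_ge0 => t _.
by have /andP[] := before_le theta (log_ratio_ge0 gpos) t.
Qed.

Lemma le_before (h : mT -> R) s s' t : (forall t, 0 <= h t) -> s <= s' ->
  before h s t <= before h s' t.
Proof.
move=> h0 ss'; rewrite /before; have [ts|ts] := ltP t s.
  by rewrite (lt_le_trans ts ss').
by rewrite mulr0 mulr_ge0.
Qed.

Let mlr := measurable_log_ratio mg1 mg2 gpos.
Let mtr := measurable_truncated_ratio mg1 mg2 mls gpos ls0.

Let intN j w (h : mT -> R) : measurable_fun setT h ->
  (N j w).-integrable setT (EFin \o h).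
Proof. by move=> mh; exact: natural_measure_integrable. Qed.

Lemma jump_sum_le n w s s' : s <= s' -> jump_sum n w s <= jump_sum n w s'.
Proof.
move=> ss'; apply: ler_sum => j _; apply: le_Rintegral => //.
- by apply: intN; exact: measurable_before.
- by apply: intN; exact: measurable_before.
- by move=> t _; apply: le_before => //; exact: log_ratio_ge0.
Qed.

Lemma likelihood_bounded n w : exists M, forall theta, theta <= tau -> L n w theta <= M.
Proof.
have [C C0 LE] := likelihood_jump_sum n w.
exists (C * expR (n%:R * integrated_gap tau)) => theta thetatau; rewrite LE.
rewrite ler_wpM2l ?(ltW C0)// ler_expR.
apply: (@le_trans _ _ (n%:R * integrated_gap theta)).
  by rewrite lerBlDr lerDl jump_sum_ge0.
rewrite ler_wpM2l//; apply: le_Rintegral => //.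
- exact: (integrable_before_gap mg1 mg2 bg1 bg2 gpos theta).
- exact: (integrable_before_gap mg1 mg2 bg1 bg2 gpos tau).
- by move=> t _; apply: le_before => //; exact: gap_ge0.
Qed.

(** For theta <= theta0, fewer jumps are counted before theta, and only the
    Lipschitz term can decrease. *)
Lemma likelihood_lower : exists2 C, 0 <= C & forall n w theta, theta <= theta0 ->
  expR (- (C * (theta0 - theta) * n%:R)) * L n w theta0 <= L n w theta.
Proof.
have [C C0 lip] := integrated_lipschitz mg1 mg2 mls bg1 bg2 bls gpos ls0.
exists C => // n w theta tt; have [K K0 LE] := likelihood_jump_sum n w.
rewrite !LE mulrCA ler_wpM2l ?(ltW K0)// -expRD ler_expR.
have := jump_sum_le n w tt.
have := ler_wpM2l (ler0n R n) (lip _ _ tt).2.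
set a := C * _; rewrite mulrBr; set x := jump_sum _ _ _; set y := jump_sum _ _ _.
rewrite [n%:R * a]mulrC; lra.
Qed.

(** A grid argument.  For theta between consecutive points s and s + eta, the sum
    over the jumps before theta is at least the one before s, which is close to
    its limit; the limit changes by at most C eta between s and theta. *)
Theorem likelihood_separation eps : 0 < eps -> exists2 c, 0 < c &
  exists B : nat -> set T, [/\ forall n, measurable (B n),
    P (B n) @[n --> \oo] --> 0%E &
    forall n w theta, ~ B n w -> theta \in `[0, tau] ->
      eps <= `|theta - theta0| ->
      L n w theta <= expR (- (c * n%:R)) * L n w theta0].
Proof.
move=> eps0.
have [c c0 sep] := excess_separation mg1 mg2 mls bg1 bg2 bls gpos ls0
  ls_before ls_after th0 thtau eps0.
have [C C0 lip] := integrated_lipschitz mg1 mg2 mls bg1 bg2 bls gpos ls0.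
(* The rate c is spent as c / 4 on the mesh, 2 * (c / 8) on the deviations; c / 2
   remains. *)
pose eta := c / (4 * (C + 1)).
have C10 : 0 < C + 1 by rewrite ltr_wpDl.
have eta0 : 0 < eta by rewrite divr_gt0// mulr_gt0.
have Ceta : C * eta <= c / 4.
  have -> : C * eta = c / 4 * (C / (C + 1)) by rewrite /eta; field; rewrite gt_eqF.
  by rewrite ler_piMr ?divr_ge0// ?ltW// ltr_pdivrMr// mul1r ltrDl.
pose b := c / 8; have b0 : 0 < b by rewrite divr_gt0.
pose K := (Num.truncn (tau / eta)).+1.
pose r := theta0 :: [seq i%:R * eta | i <- iota 0 K].
pose F (s : R) := before truncated_ratio s.
have mF s : measurable_fun setT (F s) by exact: measurable_before.
have tr0 := truncated_ratio_ge0 gpos ls0.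
have F0 s t : 0 <= F s t by have /andP[] := before_le s tr0 t.
have llnF s : mean_lln P leb la N (F s).
  apply: poisson_process_lln => //.
  exact: mean_integrable_before_ratio.
have mN j (U : set mT) : measurable U -> measurable_fun setT (fun w => N j w U).
  by move=> mU; exact: (measurable_jump_measure tau0 ppX).
have [mB B0] := mean_lln_probability mN r mF llnF b0.
exists (c / 2); first by rewrite divr_gt0.
eexists; split; [exact: mB|exact: B0|].
move=> n w theta /= /negP; rewrite -ltNge => dev_lt.
rewrite in_itv/= => /andP[t0 ttau] far.
have close s : s \in r ->
    `|empirical_mean N n (F s) w - integrated_ratio s| <= b.
  move=> sr; apply: ltW; apply: le_lt_trans dev_lt.
  by rewrite (big_rem s)//= lerDl; exact: sumr_ge0.
pose k := Num.truncn (theta / eta); pose s := k%:R * eta.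
have /andP[sth ths] : s <= theta < s + eta.
  have := truncn_itv (divr_ge0 t0 (ltW eta0)).
  rewrite -/k ler_pdivlMr// ltr_pdivrMr// -/s => /andP[->].
  by rewrite -natr1 mulrDl mul1r.
have sr : s \in r.
  rewrite inE; apply/orP; right; apply/mapP; exists k => //.
  rewrite mem_iota /= add0n ltnS; apply: le_truncn.
  by rewrite ler_pM2r ?invr_gt0.
have emp_mono : empirical_mean N n (F s) w <= empirical_mean N n (F theta) w.
  by apply: le_empirical_mean => // t; exact: le_before.
have emp_sum : jump_sum n w theta0 - jump_sum n w theta <=
    n%:R * (empirical_mean N n (F theta0) w - empirical_mean N n (F theta) w).
  rewrite /empirical_mean -mulrBr -!sumrB.
  case: n {dev_lt close emp_mono} => [|n]; first by rewrite !big_ord0 mul0r.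
  rewrite mulVKf//; apply: ler_sum => j _.
  exact: jump_log_ratio_le.
have /ler_normlP[_ close0] := close _ (mem_head _ _).
have /ler_normlP[closes _] := close _ sr.
have lips := (lip _ _ sth).1.
have sept := sep _ far.
have Cs : C * (theta - s) <= c / 4.
  by apply: le_trans Ceta; rewrite ler_wpM2l// lerBlDl ltW.
have [Cl Cl0 LE] := likelihood_jump_sum n w.
rewrite !LE mulrCA ler_wpM2l ?(ltW Cl0)// -expRD ler_expR.
have bound : integrated_gap theta - integrated_gap theta0 +
    (empirical_mean N n (F theta0) w - empirical_mean N n (F theta) w) <= - (c / 2).
  move: close0 closes emp_mono lips sept Cs; rewrite /b.
  set e0 := empirical_mean _ _ _ _; set e1 := empirical_mean _ _ _ _.
  set e2 := empirical_mean _ _ _ _.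
  lra.
have := ler_wpM2l (ler0n R n) bound; rewrite mulrDr.
move: emp_sum; set x := n%:R * (_ - _); set y := n%:R * (_ - _).
have -> : y = n%:R * integrated_gap theta - n%:R * integrated_gap theta0.
  by rewrite /y mulrBr.
have -> : n%:R * (- (c / 2)) = - (c / 2 * n%:R) by ring.
lra.
Qed.

End likelihood_separation.

(** * Maximum likelihood *)

Section maximum_likelihood.
Context {R : realType}.
Set Implicit Arguments.
Unset Strict Implicit.

(** Without convergence, [lim] is the default value 0. *)
Lemma lim_le_default (F : set_system R) (f : R -> R) (M : R) : ProperFilter F ->
  0 <= M -> (\forall x \near F, f x <= M) -> lim (f x @[x --> F]) <= M.
Proof.
move=> PF M0 fM; have [cf|ncf] := pselect (cvg (f x @[x --> F])).
  exact: limr_le.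
by rewrite (dvgP ncf).
Qed.

(** Near a point far from [theta0] the function is at most M, and so are its
    one-sided limits, while its supremum is at least [f theta0]. *)
Lemma mle_close (al be theta0 theta M eps : R) (f : R -> R) :
  0 < eps -> theta0 \in `]al, be[ -> 0 <= M -> M < f theta0 ->
  (exists C, forall x, x \in `]al, be[ -> f x <= C) ->
  (forall x, x \in `]al, be[ -> eps / 2 <= `|x - theta0| -> f x <= M) ->
  is_mle al be f theta -> `|theta - theta0| < eps.
Proof.
move=> eps0 t0I M0 Mf [C fC] far [thI mle]; rewrite ltNge; apply/negP => thfar.
have e20 : 0 < eps / 2 by rewrite divr_gt0.
move: thI; rewrite in_itv/= => /andP[alth thbe].
have f0sup : f theta0 <= sup [set f x | x in `]al, be[].
  apply: ub_le_sup; last by exists theta0.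
  by exists C => _ [x xI <-]; exact: fC.
have nearM x : al < x -> x < be -> `|x - theta| < eps / 2 -> f x <= M.
  move=> alx xbe xth; apply: far; first by rewrite in_itv/= alx.
  have := ler_distD x theta theta0; rewrite [X in _ <= X + _]distrC; lra.
have rl : rlim_in be f theta <= M.
  rewrite /rlim_in; case: ifPn => // tb; apply: lim_le_default => //.
  near=> x; have tx : theta < x by near: x; exact: nbhs_right_gt.
  apply: nearM.
  - exact: le_lt_trans alth tx.
  - by near: x; exact: nbhs_right_lt.
  - rewrite gtr0_norm ?subr_gt0// ltrBlDr addrC.
    by near: x; apply: nbhs_right_lt; rewrite ltrDl.
have ll : llim_in al f theta <= M.
  rewrite /llim_in; case: ifPn => // tb; apply: lim_le_default => //.
  near=> x; have tx : x < theta by near: x; exact: nbhs_left_lt.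
  apply: nearM.
  - by near: x; exact: nbhs_left_gt.
  - exact: lt_le_trans tx thbe.
  - rewrite distrC gtr0_norm ?subr_gt0// ltrBlDl -ltrBlDr.
    by near: x; apply: nbhs_left_gt; rewrite ltrBlDr ltrDl.
have : Num.max (rlim_in be f theta) (llim_in al f theta) <= M by rewrite ge_max rl ll.
by rewrite mle leNgt (lt_le_trans Mf).
Unshelve. all: by end_near. Qed.

End maximum_likelihood.

(** * Bayes estimators *)

Section joint_measurability.
Context d (T : measurableType d) (R : realType).
Set Implicit Arguments.
Unset Strict Implicit.
Local Notation mT := (measurableTypeR R).

(** [F] exceeds [a] at (w, s) if and only if it does so at (w, q) for some rational
    q <= s: a countable union of measurable rectangles. *)
Lemma measurable_left_continuous (F : T -> R -> R) :
  (forall s, measurable_fun setT (F ^~ s)) ->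
  (forall w s s', s <= s' -> F w s <= F w s') ->
  (forall w s, F w (s - k.+1%:R^-1) @[k --> \oo] --> F w s) ->
  measurable_fun setT (fun u : T * mT => F u.1 u.2).
Proof.
move=> mF ndF lcF mD; apply: (measurability _ (RGenOInfty.measurableE R)) => //.
move=> /= _ [_ [a ->] <-]; rewrite preimage_itvoy setTI.
rewrite [X in measurable X](_ : _ = \bigcup_(q : rat)
  ([set w | a < F w (ratr q)] `*` (`[ratr q, +oo[%classic : set mT))).
  apply: bigcupT_measurable_rat => q; apply: measurableX => //.
  exact: measurable_ltr_set.
apply/seteqP; split => [[w s] /= aF|[w s] [q _ [/= aF]]]; last first.
  by rewrite in_itv/= andbT => qs; rewrite (lt_le_trans aF)// ndF.
have [k aFk] : exists k, a < F w (s - k.+1%:R^-1).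
  have /cvgrPdist_lt/(_ (F w s - a)) := lcF w s.
  rewrite subr_gt0 => /(_ aF)[k _ /(_ k (leqnn k))/= h]; exists k.
  by have := ler_norm (F w s - F w (s - k.+1%:R^-1)); lra.
have /rat_in_itvoo[q] : s - k.+1%:R^-1 < s by rewrite ltrBlDr ltrDl invr_gt0.
rewrite in_itv/= => /andP[sq qs]; exists q => //; split => /=.
  by rewrite (lt_le_trans aFk)// ndF// ltW.
by rewrite in_itv/= andbT ltW.
Qed.

End joint_measurability.

Section left_continuity.
Context (R : realType).
Set Implicit Arguments.
Unset Strict Implicit.
Local Notation mT := (measurableTypeR R).

Lemma integral_before_left_continuous (mu : {measure set mT -> \bar R})
    (h : mT -> R) s :
  measurable_fun setT h -> (forall t, 0 <= h t) ->
  mu.-integrable setT (EFin \o h) ->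
  \int[mu]_t before h (s - k.+1%:R^-1) t @[k --> \oo] --> \int[mu]_t before h s t.
Proof.
move=> mh h0 ih; have mb u : measurable_fun setT (EFin \o before h u).
  by apply/measurable_EFinP; exact: measurable_before.
have cv : {ae mu, forall t, setT t ->
    (fun k => (before h (s - k.+1%:R^-1) t)%:E) k @[k --> \oo] --> (before h s t)%:E}.
  apply: aeW => t _; have [ts|st] := ltP t s; last first.
    have E k : before h (s - k.+1%:R^-1) t = before h s t.
      rewrite /before ltNge (le_trans _ st) ?lerBlDr ?lerDl ?invr_ge0//.
      by rewrite ltNge st.
    by under eq_fun do rewrite E; exact: cvg_cst.
  apply: cvg_near_cst; exists (Num.truncn (s - t)^-1) => // k /= kn.
  rewrite /before ts ltrBrDr -ltrBrDl.
  suff -> : k.+1%:R^-1 < s - t by [].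
  rewrite -[ltRHS]invrK ltf_pV2 ?posrE ?invr_gt0 ?subr_gt0//.
  by rewrite (lt_le_trans (truncnS_gt _))// ler_nat ltnS.
have dom : {ae mu, forall t k, setT t ->
    (`|(before h (s - k.+1%:R^-1) t)%:E| <= (h t)%:E)%E}.
  apply: aeW => t k _; have /andP[b0 bh] := before_le (s - k.+1%:R^-1) h0 t.
  by rewrite lee_fin ger0_norm.
have [ib _ cI] := dominated_convergence measurableT (fun k => mb _) (mb s) cv ih dom.
have bfin : (\int[mu]_t (before h s t)%:E)%E \is a fin_num.
  exact: integrable_fin_num ib.
by move: cI; rewrite -(fineK bfin) => /fine_cvgP[].
Qed.

End left_continuity.

Section bayes.
Context (R : realType) (al be : R) (p : R -> R).
Set Implicit Arguments.
Unset Strict Implicit.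
Local Notation leb := (@lebesgue_measure R).
Local Notation mT := (measurableTypeR R).
Local Notation I := (`]al, be[%classic : set mT).
Hypothesis p0 : forall x, x \in `]al, be[ -> 0 < p x.
Hypothesis mp : measurable_fun I p.
Hypothesis p1 : (\int[leb]_(x in `]al, be[) (p x)%:E = 1)%E.

Let mI : measurable I. Proof. exact: measurable_itv. Qed.

Let ip : leb.-integrable I (EFin \o p).
Proof.
apply/integrableP; split; first exact/measurable_EFinP.
suff -> : (\int[leb]_(x in I) `|(EFin \o p) x| = 1)%E by rewrite ltry.
rewrite -p1; apply: eq_integral => x.
by rewrite mem_setE => xI; rewrite /= ger0_norm// ltW// p0.
Qed.

Lemma prior_integrable (f : R -> R) C : measurable_fun I f ->
  (forall x, x \in `]al, be[ -> `|f x| <= C) ->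
  leb.-integrable I (EFin \o (fun x => p x * f x)).
Proof.
move=> mf fC; apply: (@le_integrable _ _ _ _ I _ _ (EFin \o (fun x => C * p x))) => //.
- by apply/measurable_EFinP; exact: measurable_funM.
- move=> x /= xI; have px := p0 xI; have := fC _ xI.
  rewrite !lee_fin !normrM (gtr0_norm px) mulrC => fx.
  by rewrite ler_pM2r// (le_trans fx)// ler_norm.
- exact: (integrableZl mI C ip).
Qed.

(** The estimator depends on the likelihood only up to a factor, which may vary
    from path to path. *)
Lemma bayes_estimatorZ (f : R -> R) (k C : R) : k != 0 -> 0 <= al ->
  measurable_fun I f -> (forall x, x \in `]al, be[ -> 0 <= f x <= C) ->
  bayes_estimator al be p (fun x => k * f x) = bayes_estimator al be p f.
Proof.
move=> k0 al0 mf fC; rewrite /bayes_estimator.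
have ifp : leb.-integrable I (EFin \o (fun x => p x * f x)).
  apply: (@prior_integrable _ C) => // x /fC/andP[f0 fle].
  by rewrite ger0_norm.
have ixfp : leb.-integrable I (EFin \o (fun x => x * p x * f x)).
  rewrite (_ : _ \o _ = EFin \o (fun x => p x * (x * f x))); last first.
    by apply/funext => x /=; rewrite mulrCA mulrA.
  apply: (@prior_integrable _ (be * C)); first exact: measurable_funM.
  move=> x xI; have /andP[f0 fle] := fC _ xI.
  move: xI; rewrite in_itv/= => /andP[alx xbe].
  have x0 : 0 <= x by rewrite (le_trans al0)// ltW.
  by rewrite ger0_norm ?mulr_ge0// ler_pM// ltW.
under eq_Rintegral do rewrite mulrCA.
rewrite RintegralZl//; under [X in _ / X]eq_Rintegral do rewrite mulrCA.
by rewrite RintegralZl// -mulf_div divff// mul1r.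
Qed.

(** The numerator of the difference is the integral of (x - theta0) p f: the points
    closer than delta contribute at most delta times the denominator, the others
    at most (be - al) M.  The denominator is at least m times the prior mass of
    the interval to the left of [theta0]. *)
Lemma bayes_estimator_close (f : R -> R) (theta0 eta delta m M C : R) :
  measurable_fun I f -> (forall x, x \in `]al, be[ -> 0 <= f x <= C) ->
  theta0 \in `]al, be[ -> 0 <= delta -> 0 <= M -> 0 < m ->
  0 < eta -> al <= theta0 - eta ->
  (forall x, x \in `]al, be[ -> delta <= `|x - theta0| -> f x <= M) ->
  (forall x, x \in `]al, be[ -> theta0 - eta < x -> x <= theta0 -> m <= f x) ->
  `|bayes_estimator al be p f - theta0| <=
    delta + (be - al) * M / (m * \int[leb]_(x in `](theta0 - eta), theta0[) p x).
Proof.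
move=> mf fC t0I d0 M0 m0 eta0 aleta far near.
have f0 x : x \in `]al, be[ -> 0 <= f x by move=> /fC/andP[].
have ifp : leb.-integrable I (EFin \o (fun x => p x * f x)).
  by apply: (@prior_integrable _ C) => // x /fC/andP[h ?]; rewrite ger0_norm.
move: (t0I); rewrite in_itv/= => /andP[alt0 t0be].
have dist x : x \in `]al, be[ -> `|x - theta0| <= be - al.
  by rewrite in_itv/= => /andP[alx xbe]; rewrite ler_norml; lra.
pose J := `](theta0 - eta), theta0[%classic : set mT.
have JI x : J x -> x \in `]al, be[.
  rewrite /J/= !in_itv/= => /andP[h1 h2].
  by rewrite (le_lt_trans aleta h1) (lt_trans h2).
have mJ : measurable J by exact: measurable_itv.
have iJ : leb.-integrable J (EFin \o p).
  by apply: (integrableS mI mJ) => // x; exact: JI.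
have mass0 : 0 < \int[leb]_(x in J) p x.
  rewrite -lte_fin /Rintegral fineK; last exact: integrable_fin_num iJ.
  apply: integral_gt0 => //.
  - rewrite /= lebesgue_measure_itv/= lte_fin ltrBlDr ltrDl eta0 -EFinB lte_fin.
    by rewrite opprB addrC subrK.
  - by apply: measurable_funS mp => // x; exact: JI.
  - by move=> x /JI; exact: p0.
have den_ge : m * \int[leb]_(x in J) p x <= \int[leb]_(x in I) (p x * f x).
  rewrite -RintegralZl//.
  rewrite [leLHS]Rintegral_mkcond [leRHS]Rintegral_mkcond; apply: le_Rintegral => //.
  - rewrite -restrict_EFin; apply/(integrable_mkcond _ _).1 => //.
    exact: (integrableZl mJ m iJ).
  - by rewrite -restrict_EFin; apply/(integrable_mkcond _ _).1.
  - move=> x _; rewrite /patch; case: ifPn => [|_].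
      rewrite inE => xJ; have xI := JI _ xJ; rewrite mem_set//.
      move: xJ; rewrite /J/= in_itv/= => /andP[h1 h2].
      by rewrite mulrC ler_pM2l ?p0// near// ltW.
    case: ifPn => //; rewrite inE => xI.
    by rewrite mulr_ge0 ?f0// ltW// p0.
have den0 : 0 < \int[leb]_(x in I) (p x * f x).
  by rewrite (lt_le_trans _ den_ge)// mulr_gt0.
have ixfp : leb.-integrable I (EFin \o (fun x => x * p x * f x)).
  rewrite (_ : _ \o _ = EFin \o (fun x => p x * (x * f x))); last first.
    by apply/funext => x /=; rewrite mulrCA mulrA.
  apply: (@prior_integrable _ ((`|al| + `|be|) * C)); first exact: measurable_funM.
  move=> x xI; have /andP[fx0 fle] := fC _ xI.
  rewrite normrM ler_pM// ?(ger0_norm fx0)//.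
  move: xI; rewrite in_itv/= => /andP[alx xbe]; rewrite ler_norml.
  have := ler_norm be; have := ler_norm (- al); rewrite normrN.
  have := normr_ge0 al; have := normr_ge0 be; lra.
set den := \int[leb]_(x in I) (p x * f x) in den_ge den0 *.
pose num := \int[leb]_(x in I) ((x - theta0) * (p x * f x)).
have idiff : leb.-integrable I (EFin \o (fun x => (x - theta0) * (p x * f x))).
  rewrite (_ : _ \o _ = EFin \o (fun x => p x * ((x - theta0) * f x))); last first.
    by apply/funext => x /=; rewrite mulrCA.
  apply: (@prior_integrable _ ((be - al) * C)).
    by apply: measurable_funM => //; exact: measurable_funB.
  move=> x xI; have /andP[fx0 fle] := fC _ xI.
  by rewrite normrM ler_pM// ?(ger0_norm fx0)// dist.
have -> : bayes_estimator al be p f - theta0 = num / den.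
  apply: (mulIf (lt0r_neq0 den0)); rewrite divfK ?lt0r_neq0//.
  rewrite mulrBl /bayes_estimator -/den divfK ?lt0r_neq0// /num /den.
  rewrite -RintegralZl// -RintegralB//; last exact: (integrableZl mI theta0 ifp).
  by apply: eq_Rintegral => x _; ring.
rewrite normrM normfV (gtr0_norm den0).
have num_le : `|num| <= delta * den + (be - al) * M.
  apply: (le_trans (le_normr_Rintegral _ idiff)) => //.
  have -> : delta * den + (be - al) * M =
      \int[leb]_(x in I) (delta * (p x * f x) + (be - al) * M * p x).
    rewrite RintegralD//; last 2 first.
    - exact: (integrableZl mI delta ifp).
    - exact: (integrableZl mI ((be - al) * M) ip).
    by rewrite !RintegralZl// /Rintegral p1/= mulr1.
  apply: le_Rintegral => //.
  - exact: (integrable_norm idiff).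
  - exact: (integrableD mI (integrableZl mI delta ifp) (integrableZl mI ((be - al) * M) ip)).
  move=> x xI; have px := p0 xI; have fx := f0 _ xI; have dx := dist _ xI.
  rewrite !normrM (gtr0_norm px) (ger0_norm fx).
  have pf0 : 0 <= p x * f x by rewrite mulr_ge0// ltW.
  have [xd|xd] := ltP `|x - theta0| delta.
    rewrite (@le_trans _ _ (delta * (p x * f x)))//; first by rewrite ler_wpM2r// ltW.
    by rewrite lerDl !mulr_ge0// ?(ltW px)// (le_trans _ dx).
  rewrite (@le_trans _ _ ((be - al) * M * p x))//; last by rewrite lerDr mulr_ge0.
  rewrite -mulrA [M * _]mulrC; apply: ler_pM => //.
  by rewrite ler_pM2l// far.
rewrite ler_pdivrMr// (le_trans num_le)// [leRHS]mulrDl lerD2l.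
rewrite mulrAC ler_pdivlMr ?mulr_gt0//.
apply: ler_wpM2l => //; rewrite mulr_ge0// subr_ge0.
by rewrite ltW// (lt_trans alt0).
Qed.

End bayes.

Section bayes_measurability.
Context d (T : measurableType d) (R : realType) (al be : R).
Set Implicit Arguments.
Unset Strict Implicit.
Local Notation mT := (measurableTypeR R).
Local Notation leb := (@lebesgue_measure R).
Local Notation I := (`]al, be[%classic : set mT).

Lemma measurable_weighted_integral (q : mT -> R) (l : T -> R -> R) :
  measurable_fun I q -> (forall x, I x -> 0 <= q x) ->
  measurable_fun setT (fun u : T * mT => l u.1 u.2) -> (forall w x, 0 <= l w x) ->
  measurable_fun setT (fun w => \int[leb]_(x in I) (q x * l w x)).
Proof.
move=> mq q0 ml l0.
have mI : measurable I by exact: measurable_itv.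
have mqI : measurable_fun setT (q \_ I) by apply/(measurable_restrictT _ _).1.
have qI0 x : 0 <= (q \_ I) x.
  by rewrite /patch; case: ifPn => //; rewrite inE => /q0.
pose f (u : T * mT) : \bar R := ((q \_ I) u.2 * l u.1 u.2)%:E.
have mf : measurable_fun setT f.
  apply/measurable_EFinP; apply: measurable_funM => //.
  exact: measurableT_comp mqI measurable_snd.
have f0 u : (0 <= f u)%E by rewrite lee_fin mulr_ge0.
have mF := measurable_fun_fubini_tonelli_F (m2 := leb) f mf f0.
rewrite (_ : (fun w => _) = fun w => fine (fubini_F leb f w)).
  exact: measurableT_comp (fine_measurable measurableT) mF.
apply/funext => w; rewrite /Rintegral /fubini_F integral_mkcond; congr fine.
apply: eq_integral => x _; rewrite /f /patch/=.
by case: ifPn => _; rewrite ?mul0r.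
Qed.

End bayes_measurability.

Section bayes_model_measurability.
Context (R : realType) (tau : R) d (T : measurableType d) (P : probability T R).
Set Implicit Arguments.
Unset Strict Implicit.
Variables (g1 g2 ls : R -> R) (X : nat -> T -> cumulative R R) (al be : R) (p : R -> R).
Local Notation mT := (measurableTypeR R).
Local Notation I := (`]al, be[%classic : set mT).
Hypothesis tau0 : 0 < tau.
Hypotheses (mg1 : measurable_fun `[0, tau] g1) (mg2 : measurable_fun `[0, tau] g2).
Hypotheses (bg1 : [bounded g1 t : R^o | t in `[0, tau]])
  (bg2 : [bounded g2 t : R^o | t in `[0, tau]]).
Hypothesis gpos : forall t, t \in `[0, tau] -> 0 < g1 t /\ g1 t < g2 t.
Hypothesis ppX : forall j, poisson_process P tau ls (X j).
Hypotheses (al0 : 0 <= al) (betau : be <= tau).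
Hypothesis p0 : forall x, x \in `]al, be[ -> 0 < p x.
Hypothesis mp : measurable_fun I p.
Hypothesis p1 : (\int[lebesgue_measure]_(x in `]al, be[) (p x)%:E = 1)%E.

Let L n w := likelihood tau (switch_intensity g1 g2) n (fun j => X j w).
Let js := jump_sum tau g1 g2 X.
Let G := integrated_gap tau g1 g2.

Let natN j w : natural_measure (jump_measure tau (X j w)).
Proof. by apply: natural_jump_measure => // t; exact: pp_counting. Qed.

Let mlr := measurable_log_ratio mg1 mg2 gpos.
Let lr0 := log_ratio_ge0 gpos.

Let ndG : nondecreasing_fun G.
Proof.
move=> s s' ss'; apply: le_Rintegral => //.
- exact: (integrable_before_gap mg1 mg2 bg1 bg2 gpos s).
- exact: (integrable_before_gap mg1 mg2 bg1 bg2 gpos s').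
- by move=> t _; apply: le_before => //; exact: gap_ge0.
Qed.

Let mG : measurable_fun setT G.
Proof. exact: nondecreasing_measurable. Qed.

Lemma measurable_jump_sum n :
  measurable_fun setT (fun u : T * mT => js n u.1 u.2).
Proof.
apply: measurable_sum => j.
apply: (@measurable_left_continuous _ T R
  (fun w s => \int[jump_measure tau (X j w)]_t before (log_ratio tau g1 g2) s t)).
- move=> s; apply: measurable_random_integral.
    by move=> U mU; exact: (measurable_jump_measure tau0 ppX).
  exact: measurable_before.
- move=> w s s' ss'; apply: le_Rintegral => //.
  + by apply: natural_measure_integrable => //; exact: measurable_before.
  + by apply: natural_measure_integrable => //; exact: measurable_before.
  + by move=> t _; exact: le_before.
- move=> w s; apply: integral_before_left_continuous => //.
  exact: natural_measure_integrable.
Qed.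

Let ell n w (x : R) := expR (n%:R * G x - js n w x).

Let ell0 n w x : 0 <= ell n w x. Proof. exact: expR_ge0. Qed.

Let mell n : measurable_fun setT (fun u : T * mT => ell n u.1 u.2).
Proof.
apply: measurableT_comp; first exact: measurable_expR.
apply: measurable_funB; last exact: measurable_jump_sum.
apply: measurable_funM => //.
exact: measurableT_comp mG measurable_snd.
Qed.

Lemma measurable_likelihood n w : measurable_fun I (L n w).
Proof.
have [C C0 LE] := likelihood_jump_sum tau0 mg1 mg2 bg1 bg2 gpos ppX n w.
rewrite (_ : L n w = fun x => C * expR (n%:R * G x - js n w x)); last exact/funext.
apply: measurable_funM => //; apply: measurableT_comp; first exact: measurable_expR.
apply: measurable_funB; first by apply: measurable_funM => //; exact: measurable_funTS.
apply: nondecreasing_measurable; first exact: measurable_itv.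
by move=> s s' ss'; exact: (jump_sum_le tau0 mg1 mg2 gpos ppX).
Qed.

(** The estimator is a quotient of integrals of the jointly measurable function
    exp (n G - M), by the Tonelli theorem. *)
Lemma measurable_bayes_estimator n :
  measurable_fun setT (fun w => bayes_estimator al be p (L n w)).
Proof.
have E w : bayes_estimator al be p (L n w) = bayes_estimator al be p (ell n w).
  have [C C0 LE] := likelihood_jump_sum tau0 mg1 mg2 bg1 bg2 gpos ppX n w.
  have [M LM] := likelihood_bounded tau0 mg1 mg2 bg1 bg2 gpos ppX n w.
  have LE' : L n w = fun x => C * ell n w x by exact/funext.
  rewrite LE'; apply: (@bayes_estimatorZ _ _ _ _ p0 mp p1 _ _ (C^-1 * M)) => //.
  - by rewrite gt_eqF.
  - rewrite (_ : ell n w = fun x => C^-1 * L n w x).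
      by apply: measurable_funM => //; exact: measurable_likelihood.
    by apply/funext => x; rewrite LE' mulKf// gt_eqF.
  - move=> x; rewrite in_itv/= => /andP[_ xbe]; rewrite ell0/= ler_pdivlMl//.
    have := LM x; rewrite -[likelihood _ _ _ _ _]/(L n w x) LE'; apply.
    by rewrite (le_trans (ltW xbe)).
under eq_fun do rewrite E.
have pI x : I x -> 0 <= p x by move=> /p0/ltW.
apply: measurable_funM.
  apply: measurable_weighted_integral => //.
  - exact: measurable_funM.
  - move=> x xI; rewrite mulr_ge0 ?pI//.
    by move: xI; rewrite /= in_itv/= => /andP[/ltW/(le_trans al0)].
apply: (eq_measurable_fun (fun w =>
    (\int[lebesgue_measure]_(x in I) (p x * ell n w x)) `^ (-1))) => [w _|].
  by rewrite powR_inv1// Rintegral_ge0// => x /pI px; rewrite mulr_ge0.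
have mW := measurable_weighted_integral mp pI (mell n) (ell0 n).
pose pinv (y : R) := y `^ (-1).
have mpinv : measurable_fun setT pinv by exact: measurable_powR.
exact: measurableT_comp mpinv mW.
Qed.

End bayes_model_measurability.

(** * The Kullback-Leibler distance and consistency *)

Section kullback_leibler_minimum.
Context (R : realType) (tau : R) (g1 g2 ls : R -> R) (theta0 : R).
Set Implicit Arguments.
Unset Strict Implicit.
Hypotheses (mg1 : measurable_fun `[0, tau] g1) (mg2 : measurable_fun `[0, tau] g2)
  (mls : measurable_fun `[0, tau] ls).
Hypothesis gpos : forall t, t \in `[0, tau] -> 0 < g1 t /\ g1 t < g2 t.
Hypothesis ls0 : forall t, t \in `[0, tau] -> 0 < ls t.
Hypothesis ls_before : forall t, t \in `[0, tau] -> t < theta0 ->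
  ls t * ln (g2 t / g1 t) < g2 t - g1 t.
Hypothesis ls_after : forall t, t \in `[0, tau] -> theta0 <= t ->
  g2 t - g1 t < ls t * ln (g2 t / g1 t).

Let lam := switch_intensity g1 g2.

Let lam_gt0 theta t : t \in `[0, tau] -> 0 < lam theta t.
Proof.
move=> /gpos[g10 g12]; rewrite /lam /switch_intensity; case: (ltP t theta) => _ /=.
  by rewrite mulr1 mulr0 addr0.
by rewrite mulr0 mulr1 add0r (lt_trans g10).
Qed.

Let measurable_lam theta : measurable_fun `[0, tau] (lam theta).
Proof.
apply: measurable_funD; apply: measurable_funM => //; apply: measurable_funTS.
  rewrite (_ : (fun t => _) = \1_(`]-oo, theta[ : set R)); first exact: measurable_indic.
  by apply/funext => t; rewrite indicE mem_setE in_itv.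
rewrite (_ : (fun t => _) = \1_(`[theta, +oo[ : set R)); first exact: measurable_indic.
by apply/funext => t; rewrite indicE mem_setE in_itv/= andbT.
Qed.

(** The integrands are compared pointwise: they agree outside the interval between
    theta and [theta0], and there their difference has the sign of the
    hypothesis. *)
Lemma kullback_leibler_le theta :
  (kullback_leibler tau lam ls theta0 <= kullback_leibler tau lam ls theta)%E.
Proof.
have mint th : measurable_fun `[0, tau]
    (fun t => ((lam th t / ls t - 1 - ln (lam th t / ls t)) * ls t)%:E).
  have mr : measurable_fun `[0, tau] (fun t => lam th t / ls t).
    by apply: measurable_funM => //; exact: measurable_inv_comp.
  apply/measurable_EFinP; apply: measurable_funM => //.
  apply: measurable_funB; first exact: measurable_funB.
  exact: measurable_ln_comp.
have u0 th t : t \in `[0, tau] -> 0 < lam th t / ls t.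
  by move=> tI; rewrite divr_gt0 ?lam_gt0 ?ls0.
have ln_le u : 0 < u -> ln u <= u - 1 :> R.
  by move=> ugt0; have := expR_ge1Dx (ln u); rewrite lnK ?posrE//; lra.
apply: ge0_le_integral => //; try exact: mint.
- move=> t tI; rewrite lee_fin mulr_ge0 ?subr_ge0 ?ln_le ?u0//.
  exact/ltW/ls0.
- move=> t tI; rewrite lee_fin.
  have E th : (lam th t / ls t - 1 - ln (lam th t / ls t)) * ls t =
      lam th t - ls t * ln (lam th t) - (ls t - ls t * ln (ls t)).
    rewrite ln_div ?posrE ?lam_gt0 ?ls0//; field.
    by rewrite gt_eqF// ls0.
  rewrite !E lerD2r /lam /switch_intensity.
  have [g10 g12] := gpos tI; have g20 := lt_trans g10 g12.
  have lnE : ln (g2 t / g1 t) = ln (g2 t) - ln (g1 t) by rewrite ln_div ?posrE.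
  have [t0|t0] := ltP t theta0; have [tt|tt] := ltP t theta;
    rewrite /= ?mulr1 ?mulr0 ?addr0 ?add0r//.
  + by have := ls_before tI t0; rewrite lnE mulrBr; lra.
  + by have := ls_after tI t0; rewrite lnE mulrBr; lra.
Qed.

End kullback_leibler_minimum.

Theorem mainTheorem1 (R : realType) (tau al be theta0 : R)
  (g1 g2 h1 h2 : R -> R)
  (lam := switch_intensity g1 g2)
  (lamstar := switch_intensity (fun t => g1 t + h1 t)
                               (fun t => g2 t + h2 t) theta0)
  (d : measure_display) (T : measurableType d) (P : probability T R)
  (X : nat -> T -> cumulative R R)
  (L := fun (n : nat) (w : T) => likelihood tau lam n (fun j => X j w)) :
  0 < tau -> 0 <= al -> be <= tau -> theta0 \in `]al, be[ ->
  measurable_fun `[0, tau] g1 -> measurable_fun `[0, tau] g2 ->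
  measurable_fun `[0, tau] lamstar ->
  [bounded g1 t : R^o | t in `[0, tau]] ->
  [bounded g2 t : R^o | t in `[0, tau]] ->
  [bounded lamstar t : R^o | t in `[0, tau]] ->
  (forall t, t \in `[0, tau] -> 0 < g1 t /\ 0 < g2 t /\ g1 t < g2 t) ->
  (forall t, t \in `[0, tau] -> 0 < lamstar t) ->
  (forall t, t \in `[0, tau] ->
     0 < g1 t + h1 t /\
     g1 t + h1 t < (g2 t - g1 t) / ln (g2 t / g1 t) /\
     (g2 t - g1 t) / ln (g2 t / g1 t) < g2 t + h2 t) ->
  (forall j, poisson_process P tau lamstar (X j)) ->
  independent_processes P tau X ->
  (forall theta, theta \in `]al, be[ ->
     (kullback_leibler tau lam lamstar theta0 <=
      kullback_leibler tau lam lamstar theta)%E) /\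
  (forall thetahat : nat -> {RV P >-> R},
     (forall n w, is_mle al be (L n w) (thetahat n w)) ->
     cvg_in_probability P (fun n w => thetahat n w) theta0) /\
  (forall p : R -> R,
     {within `]al, be[, continuous p} ->
     (forall x, x \in `]al, be[ -> 0 < p x) ->
     (\int[lebesgue_measure]_(x in `]al, be[) (p x)%:E = 1)%E ->
     cvg_in_probability P (fun n w => bayes_estimator al be p (L n w)) theta0).
Proof.
move=> tau0 al0 betau t0I mg1 mg2 mls bg1 bg2 bls gpos' ls0 hh ppX indX.
have gpos t : t \in `[0, tau] -> 0 < g1 t /\ g1 t < g2 t by move=> /gpos'[? []].
have ratio_gt0 t : t \in `[0, tau] -> 0 < ln (g2 t / g1 t) by exact: ln_ratio_gt0.
have ls_before t : t \in `[0, tau] -> t < theta0 ->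
    lamstar t * ln (g2 t / g1 t) < g2 t - g1 t.
  move=> tI t0; have [_ [h _]] := hh t tI.
  rewrite -ltr_pdivlMr ?ratio_gt0// /lamstar /switch_intensity t0.
  by rewrite leNgt t0/= mulr1 mulr0 addr0.
have ls_after t : t \in `[0, tau] -> theta0 <= t ->
    g2 t - g1 t < lamstar t * ln (g2 t / g1 t).
  move=> tI t0; have [_ [_ h]] := hh t tI.
  rewrite -ltr_pdivrMr ?ratio_gt0// /lamstar /switch_intensity t0.
  by rewrite [t < theta0]ltNge t0/= mulr1 mulr0 add0r.
move: (t0I); rewrite in_itv/= => /andP[alt0 t0be].
have th0 : 0 < theta0 by exact: le_lt_trans al0 alt0.
have thtau : theta0 < tau by exact: lt_le_trans t0be betau.
have inI x : x \in `]al, be[ -> x \in `[0, tau].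
  by rewrite !in_itv/= => /andP[/ltW/(le_trans al0)-> /ltW/le_trans->].
have sep := likelihood_separation tau0 th0 thtau mg1 mg2 mls bg1 bg2 bls
  gpos ls0 ls_before ls_after ppX indX.
have L0 n w x : 0 < L n w x.
  exact: (likelihood_gt0 tau0 mg1 mg2 bg1 bg2 gpos ppX).
have Lbound n w : exists C, forall x, x \in `]al, be[ -> L n w x <= C.
  have [C LC] := likelihood_bounded tau0 mg1 mg2 bg1 bg2 gpos ppX n w.
  by exists C => x; rewrite in_itv/= => /andP[_ /ltW xbe]; apply: LC; exact: le_trans betau.
split; first by move=> theta _; exact: kullback_leibler_le.
split.
- move=> thetahat mle eps eps0.
  have e20 : 0 < eps / 2 by rewrite divr_gt0.
  have [c c0 [B [mB B0 LB]]] := sep _ e20.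
  apply: (cvg_probability_sub _ mB B0).
    move=> n; apply: measurable_ler_set => //.
    by apply: measurableT_comp => //; apply: measurable_funB.
  (* For n = 0 the factor exp (- c n) is 1 and nothing is gained. *)
  exists 1%N => // n /= n0 w /= far; apply: contrapT => nB.
  have n_gt0 : 0 < n%:R :> R by rewrite ltr0n.
  have := mle_close eps0 t0I _ _ (Lbound n w) _ (mle n w).
  move=> /(_ (expR (- (c * n%:R)) * L n w theta0)).
  rewrite mulr_ge0 ?expR_ge0 ?ltW//= => /(_ isT).
  rewrite gtr_pMl// -[ltRHS]expR0 ltr_expR oppr_lt0 mulr_gt0//= => /(_ isT) H.
  have : `|thetahat n w - theta0| < eps.
    by apply: H => x xI xfar; apply: LB => //; exact: inI.
  by rewrite ltNge far.
- move=> p cp p0 p1 eps eps0.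
  have mp : measurable_fun (`]al, be[%classic : set (measurableTypeR R)) p.
    exact: subspace_continuous_measurable_fun.
  have e20 : 0 < eps / 2 by rewrite divr_gt0.
  have [c c0 [B [mB B0 LB]]] := sep _ e20.
  have [C C0 lower] := likelihood_lower theta0 tau0 mg1 mg2 mls bg1 bg2 bls gpos ls0 ppX.
  apply: (cvg_probability_sub _ mB B0).
    move=> n; apply: measurable_ler_set => //.
    apply: measurableT_comp => //; apply: measurable_funB => //.
    exact: measurable_bayes_estimator.
  (* On the interval of length eta to the left of theta0 the likelihood loses at
     most a factor exp (- c n / 2), against exp (- c n) for the far points. *)
  pose eta := Num.min (theta0 - al) (c / (2 * (C + 1))).
  have C10 : 0 < C + 1 by rewrite ltr_wpDl.
  have eta0 : 0 < eta by rewrite lt_min subr_gt0 alt0 divr_gt0// mulr_gt0.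
  have aleta : al <= theta0 - eta by rewrite lerBrDr -lerBrDl ge_min lexx.
  have Ceta : C * eta <= c / 2.
    apply: (@le_trans _ _ (C * (c / (2 * (C + 1))))).
      by rewrite ler_wpM2l// ge_min lexx orbT.
    have -> : C * (c / (2 * (C + 1))) = c / 2 * (C / (C + 1)).
      by field; rewrite gt_eqF.
    by rewrite ler_piMr ?divr_ge0// ?ltW// ltr_pdivrMr// mul1r ltrDl.
  pose mass := \int[lebesgue_measure]_(x in `](theta0 - eta), theta0[) p x.
  have albe : 0 <= be - al by rewrite subr_ge0 ltW// (lt_trans alt0).
  have c20 : 0 < c / 2 by rewrite divr_gt0.
  near=> n; move=> w /= far; apply: contrapT => nB.
  (* Since exp y >= 1 + y, this n makes the contribution of the far parameters less
     than eps / 2. *)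
  have nbig : (be - al) / mass / (eps / 2) / (c / 2) < n%:R.
    by near: n; exact: nbhs_infty_gtr.
  have [K LK] := Lbound n w.
  have close := @bayes_estimator_close R al be p p0 mp p1 (L n w) theta0 eta (eps / 2)
    (expR (- (C * eta * n%:R)) * L n w theta0) (expR (- (c * n%:R)) * L n w theta0) K.
  have {close} : `|bayes_estimator al be p (L n w) - theta0| <= eps / 2 + (be - al) *
      (expR (- (c * n%:R)) * L n w theta0) /
      (expR (- (C * eta * n%:R)) * L n w theta0 * mass).
    apply: close => //.
    - exact: measurable_likelihood.
    - by move=> x xI; rewrite ltW//= LK.
    - exact: ltW.
    - by rewrite mulr_ge0 ?expR_ge0// ltW.
    - by rewrite mulr_gt0// expR_gt0.
    - by move=> x xI xfar; apply: LB => //; exact: inI.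
    - move=> x xI xeta xt0; apply: le_trans (lower n w x xt0).
      rewrite ler_pM2r// ler_expR lerN2 ler_wpM2r// ler_wpM2l//.
      by rewrite lerBlDl -lerBlDr ltW.
  rewrite leNgt => /negP; apply; apply: lt_le_trans far.
  pose y := (c - C * eta) * n%:R.
  have ny : c / 2 * n%:R <= y by rewrite ler_wpM2r//; lra.
  have -> : (be - al) * (expR (- (c * n%:R)) * L n w theta0) /
      (expR (- (C * eta * n%:R)) * L n w theta0 * mass) = (be - al) / mass * expR (- y).
    have -> : - (c * n%:R) = - y + - (C * eta * n%:R) by rewrite /y; ring.
    rewrite expRD; set A := expR (- y); set D := expR _; set Lw := L _ _ _.
    have h : A * D * Lw / (D * Lw) = A.
      have D0 : 0 < D by exact: expR_gt0.
      have Lw0 : 0 < Lw by exact: L0.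
      by field; rewrite !gt_eqF.
    rewrite -[in RHS]h invfM; set u := (D * Lw)^-1; set v := mass^-1.
    ring.
  rewrite -ltrBrDl (_ : eps - eps / 2 = eps / 2); last by field.
  rewrite expRN ltr_pdivrMr ?expR_gt0//.
  apply: (@lt_le_trans _ _ (eps / 2 * y)); last first.
    apply: ler_wpM2l; first exact: ltW.
    by apply: le_trans (expR_ge1Dx y); rewrite lerDr.
  apply: (@lt_le_trans _ _ (eps / 2 * (c / 2 * n%:R))); last first.
    by apply: ler_wpM2l ny; exact: ltW.
  by rewrite -ltr_pdivrMl// -ltr_pdivrMl// mulrC -[_^-1 * _]mulrC.
Unshelve. all: by end_near. Qed.
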